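(* Let $K$ be a field, let $k\ge 2$, and let $\Delta$ be a $(d,r)$-forest with $k$ facets. Then the Hilbert series of $K[\Delta]$ is $$\frac{k}{(1-t)^{d+1}}-\frac{k-1}{(1-t)^{r+1}}.$$ The depth of $K[\Delta]$ is $r+2$, so $K[\Delta]$ is Cohen-Macaulay if and only if $r=d-1$. For all $i\ge1$ the Betti numbers are $$b_i(K[\Delta])=b_{i,i+1}(K[\Delta])=\left|k\binom{(k-1)(d-r)}{i+1}-(k-1)\binom{k(d-r)}{i+1}\right|.$$
   Context: A simplex of dimension $d$ is the full simplicial complex on $d+1$ vertices; the simplex of dimension $-1$ is $\{\emptyset\}$. Fat forests are defined recursively: a simplex $F_1$ of dimension $\ge 0$ is a fat forest; if $F_1,\dots,F_k$ are simplices and $G_{k-1}=F_1\cup\cdots\cup F_{k-1}$ is a fat forest, then $G_{k-1}\cup F_k$ is a fat forest provided $G_{k-1}\cap F_k$ is a simplex of dimension $\ge -1$ (dimension $-1$ meaning that $G_{k-1}$ and $F_k$ are disjoint). A $(d,r)$-forest is a fat forest $F_1\cup\cdots\cup F_k$ built in this way in which every $F_i$ ($1\le i\le k$) is a $d$-simplex and $(F_1\cup\cdots\cup F_{i-1})\cap F_i$ is an $r$-simplex for $i=2,\dots,k$. It has $k$ facets when $F_1,\dots,F_k$ are its pairwise distinct facets (maximal faces), so that $-1\le r<d$. For a simplicial complex $\Delta$ with vertex set $\{1,\dots,n\}$, the Stanley-Reisner ring is $K[\Delta]=S/I$ with $S=K[x_1,\dots,x_n]$, where $I$ is generated by the squarefree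 monomials $x_{i_1}\cdots x_{i_m}$ with $\{i_1,\dots,i_m\}\notin\Delta$, graded with $\deg x_i=1$. The Hilbert series is $\sum_{j\ge0}\dim_K(K[\Delta]_j)t^j$. The graded Betti numbers are $b_{i,j}=\dim_K\mathrm{Tor}^S_{i,j}(K[\Delta],K)$, with $b_i=\sum_j b_{i,j}$. *)

(* Defs.v *)
From HB Require Import structures.
From mathcomp Require Import all_boot all_order all_algebra.
From mathcomp Require Import generic_quotient ring_quotient fraction boolp.
From mathcomp.multinomials Require Import mpoly.

Set Implicit Arguments.
Unset Strict Implicit.
Unset Printing Implicit Defensive.

Import Order.TTheory GRing.Theory Num.Theory.

Local Open Scope ring_scope.
Local Open Scope quotient_scope.

Notation "x %:F" := (@FracField.tofrac _ x) : ring_scope.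

Section Complexes.
Variable T : finType.
Implicit Types (C : {set {set T}}) (F : {set T}) (Fs : seq {set T}) (d r : int).

(* The full simplex on the vertex set F is [powerset F]; for F empty it is
   {set0}, the simplex of dimension -1. *)
Definition is_simplex_of_dim d C :=
  exists F, C = powerset F /\ #|F|%:Z - 1 = d.

Definition is_simplex C := exists2 d, -1 <= d & is_simplex_of_dim d C.

Definition complex_of Fs : {set {set T}} := \bigcup_(F <- Fs) powerset F.

Definition facets C : {set {set T}} :=
  [set F in C | [forall G in C, (F \subset G) ==> (G == F)]].

(* [fat_forest Fs]: the successive unions of the simplices on the members
   of Fs, taken in this order, are a construction of a fat forest. *)
Inductive fat_forest : seq {set T} -> Prop :=
| fat_forest1 F : F != set0 -> fat_forest [:: F]
| fat_forest_rcons Fs F :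
    fat_forest Fs -> is_simplex (complex_of Fs :&: powerset F) ->
    fat_forest (rcons Fs F).

(* The parameter k counts the facets.  For k >= 2 the conditions force
   -1 <= r < d. *)
Definition dr_forest d r (k : nat) C := exists Fs : seq {set T},
  [/\ fat_forest Fs,
      forall F, F \in Fs -> is_simplex_of_dim d (powerset F),
      forall i, (0 < i < size Fs)%N ->
        is_simplex_of_dim r
          (complex_of (take i Fs) :&: powerset (nth set0 Fs i)),
      C = complex_of Fs
    & [/\ uniq Fs, size Fs = k & facets C =i Fs]].

End Complexes.

(* The vertex set is all of 'I_n, so every singleton is a face. *)
Record scomplex (n : nat) := SComplex {
  faces :> {set {set 'I_n}};
  set0_face : set0 \in faces;
  sub_face : forall F G : {set 'I_n}, G \in faces -> F \subset G -> F \in faces;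
  vertex_face : forall i, [set i] \in faces
}.

Section RingInvariants.
Variable A : comNzRingType.
Implicit Types (s : seq A) (x g : A).

Definition in_ideal s x :=
  exists c : nat -> A, x = \sum_(i < size s) c i * s`_i.

Definition regular_seq s :=
  (forall i, (i < size s)%N -> forall g,
     in_ideal (take i s) (s`_i * g) -> in_ideal (take i s) g)
  /\ ~ in_ideal s 1.

(* p is the largest length of an A-regular sequence in m, i.e. the
   grade of m on A; the elements of a sequence need not be homogeneous. *)
Definition is_depth (m : A -> Prop) (p : nat) :=
  (exists s, [/\ size s = p, forall x, x \in s -> m x & regular_seq s])
  /\ (forall s, (forall x, x \in s -> m x) -> regular_seq s ->
        (size s <= p)%N).

(* The chain P 0 < P 1 < ... < P q; the values P i for i > q are irrelevant.
   [prime_idealr] bundles boolean membership, which is no restriction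
   classically. *)
Definition prime_chain (q : nat) (P : nat -> prime_idealr A) :=
  forall i, (i < q)%N ->
    (forall x, (x \in P i) -> (x \in P i.+1))
    /\ (exists2 x, x \in P i.+1 & x \notin P i).

Definition is_krull_dim (p : nat) :=
  (exists P, prime_chain p P)
  /\ (forall q P, prime_chain q P -> (q <= p)%N).

End RingInvariants.

Definition has_dim (K : fieldType) (V : lmodType K) (W : V -> Prop) (m : nat) :=
  exists b : 'I_m -> V, (forall i, W (b i)) /\
    forall w, W w -> exists! c : 'rV[K]_m, w = \sum_(i < m) c 0 i *: b i.

Definition sqfree_mon (K : fieldType) n (F : {set 'I_n}) : {mpoly K[n]} :=
  \prod_(i in F) 'X_i.

Section StanleyReisner.
Variables (K : fieldType) (n : nat) (D : scomplex n).

Local Notation S := {mpoly K[n]}.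

Definition SR_ideal (p : S) : bool :=
  `[< exists c : {set 'I_n} -> S,
        p = \sum_(F : {set 'I_n} | F \notin faces D) c F * sqfree_mon K F >].

Lemma SR_ideal_closed : idealr_closed SR_ideal.
Proof.
split.
- apply/asboolP; exists (fun=> 0).
  by rewrite big1 // => F _; rewrite mul0r.
- apply/negP => /asboolP[c].
  move=> /(congr1 (meval (fun=> 0 : K))); rewrite rmorph1 rmorph_sum /=.
  rewrite big1 => [/eqP|F FnD]; first by rewrite oner_eq0.
  rewrite rmorphM /= /sqfree_mon rmorph_prod /=.
  have [F0|[i iF]] := set_0Vmem F; first by rewrite F0 set0_face in FnD.
  by rewrite (bigD1 i) //= mevalXU mul0r mulr0.
- move=> a p q /asboolP[c ->] /asboolP[e ->]; apply/asboolP.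
  exists (fun F => a * c F + e F); rewrite mulr_sumr -big_split /=.
  by apply: eq_bigr => F _; rewrite mulrDl mulrA.
Qed.

HB.instance Definition _ := isIdealr.Build S SR_ideal SR_ideal_closed.

Definition SR_ring : Type := {ideal_quot (SR_ideal : idealr S)}.

HB.instance Definition _ := GRing.ComNzRing.on SR_ring.

Definition SR_pi (p : S) : SR_ring := 
  \pi_({ideal_quot (SR_ideal : idealr S)}) p.

HB.instance Definition _ := GRing.RMorphism.copy SR_pi
  \pi_({ideal_quot (SR_ideal : idealr S)}).

Definition SR_scale (c : K) (a : SR_ring) : SR_ring := SR_pi c%:MP * a.

Lemma SR_scaleA c e a : SR_scale c (SR_scale e a) = SR_scale (c * e) a.
Proof. by rewrite /SR_scale mulrA -rmorphM -mpolyCM. Qed.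

Lemma SR_scale1 : left_id 1 SR_scale.
Proof. by move=> a; rewrite /SR_scale mpolyC1 rmorph1 mul1r. Qed.

Lemma SR_scaleDr : right_distributive SR_scale +%R.
Proof. by move=> c a b; rewrite /SR_scale mulrDr. Qed.

Lemma SR_scaleDl a : {morph SR_scale^~ a : c e / c + e}.
Proof. by move=> c e; rewrite /SR_scale mpolyCD rmorphD mulrDl. Qed.

HB.instance Definition _ := GRing.Zmodule_isLmodule.Build K SR_ring
  SR_scaleA SR_scale1 SR_scaleDr SR_scaleDl.

(* homogeneous of degree z, for deg x_i = 1; 0 has every degree, and is the
   only such element when z < 0 *)
Definition homog_of (z : int) (p : S) :=
  forall m, m \in msupp p -> (mdeg m)%:Z = z.

(* the graded component of degree z of K[D] *)
Definition SR_homog (z : int) (a : SR_ring) :=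
  exists2 p, homog_of z p & a = SR_pi p.

(* the graded maximal ideal (x_1, ..., x_n) of K[D] *)
Definition SR_max (a : SR_ring) :=
  in_ideal [seq SR_pi 'X_i | i <- enum 'I_n] a.

Definition SR_depth (p : nat) := is_depth SR_max p.

(* For the graded algebra K[D], depth means depth at the graded maximal
   ideal. *)
Definition SR_CohenMacaulay := exists2 p, SR_depth p & is_krull_dim SR_ring p.

(* A rational function f = p / q is the expansion of the series sum_j h_j t^j
   when q * (sum_j h_j t^j) = p as formal power series. *)
Definition expands_to (f : {fraction {poly int}}) (h : nat -> int) :=
  exists p q : {poly int},
    [/\ q != 0, f = p%:F / q%:F
      & forall m, \sum_(i < m.+1) q`_i * h (m - i)%N = p`_m].

Definition SR_hilbert_series (f : {fraction {poly int}}) :=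
  exists h : nat -> nat,
    (forall j : nat, has_dim (SR_homog j%:Z) (h j))
    /\ expands_to f (fun j => (h j)%:Z).

(* Graded resolutions ... -> F_1 -> F_0 -> K[D] -> 0 by finitely generated free
   graded S-modules.  F_i consists of row vectors; its l-th basis element has
   degree fr_deg i l, i.e. F_i is the sum of the S(- fr_deg i l); F_{i+1} -> F_i
   is u |-> u *m fr_diff i, and F_0 -> K[D] sends the l-th basis element
   to fr_aug l. *)
Record free_resolution := FreeResolution {
  fr_rank : nat -> nat;
  fr_deg : forall i, 'I_(fr_rank i) -> int;
  fr_diff : forall i, 'M[S]_(fr_rank i.+1, fr_rank i);
  fr_aug : 'I_(fr_rank 0) -> SR_ring;
  fr_diff_homog : forall i l m,
    homog_of (fr_deg l - fr_deg m) (fr_diff i l m);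
  fr_aug_homog : forall l, SR_homog (fr_deg l) (fr_aug l);
  fr_aug_surj : forall a, exists u : 'rV[S]_(fr_rank 0),
    a = \sum_l SR_pi (u 0 l) * fr_aug l;
  fr_exact0 : forall u : 'rV[S]_(fr_rank 0),
    \sum_l SR_pi (u 0 l) * fr_aug l = 0
      <-> exists v, u = v *m fr_diff 0;
  fr_exactS : forall i (u : 'rV[S]_(fr_rank i.+1)),
    u *m fr_diff i = 0 <-> exists v, u = v *m fr_diff i.+1
}.

Section Tor.
Variable F : free_resolution.

(* the differential F_{i+1} (x) K -> F_i (x) K, where K = S / (x_1, ..., x_n) *)
Definition tor_diff i : 'M[K]_(fr_rank F i.+1, fr_rank F i) :=
  map_mx (mcoeff 0%MM) (fr_diff F i).

(* the component of degree j of F_i (x) K, as a row space *)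
Definition tor_comp i (j : int) : 'M[K]_(fr_rank F i) :=
  diag_mx (\row_l (fr_deg l == j)%:R).

Definition tor_cycles i (j : int) : 'M[K]_(fr_rank F i) :=
  match i return 'M[K]_(fr_rank F i) with
  | 0%N => tor_comp 0 j
  | i'.+1 => (tor_comp i'.+1 j :&: kermx (tor_diff i'))%MS
  end.

Definition tor_boundaries i (j : int) : 'M[K]_(fr_rank F i.+1, fr_rank F i) :=
  tor_comp i.+1 j *m tor_diff i.

(* b_{i,j}: the dimension over K of Tor_{i,j}(K[D], K) = H_i(F (x) K)_j,
   which does not depend on F *)
Definition gbetti i (j : int) : nat :=
  (\rank (tor_cycles i j) - \rank (tor_boundaries i j))%N.

(* the sum of the b_{i,j} over all j; b_{i,j} = 0 unless j is the degree of
   a basis element of F_i *)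
Definition betti i : nat :=
  \sum_(j <- undup [seq fr_deg l | l <- enum 'I_(fr_rank F i)]) gbetti i j.

End Tor.

End StanleyReisner.

(* Main.v *)
(** The squarefree monomial ideal of a complex D consists of the polynomials
    whose coefficients vanish on the monomials with support in D, so that union
    and intersection of complexes become intersection and sum of ideals. With
    facets F_a and gluing simplices G_b this gives the exact sequence
      0 -> K[D] -> (+)_a K[F_a] -> (+)_(b > 0) K[G_b] -> 0,
    and everything is read off it.

    Hilbert series: count monomials.

    Depth: the elementary symmetric polynomials e_1, ..., e_(r+2) of all the
    variables restrict to those of each simplex, where they are regular, and
    regularity passes through the gluing. Conversely D becomes disconnected
    after the removal of one G_b, which yields a nonzero Koszul homology class
    of degree n - r - 2.

    Krull dimension: by the criterion of Coquand and Lombardi, a chain of primes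
    of length d + 2 would give d + 2 elements of K[D] that are algebraically
    independent over K, against the growth of the Hilbert function.

    Betti numbers: the Koszul resolutions of the K[F_a] and K[G_b] form a
    complex of free modules whose only homology is K[D]. A graded resolution of
    K[D] maps to it with an exact mapping cone, which stays exact over K, where
    only the incidence map of the tree of facets survives. *)
From HB Require Import structures.
From mathcomp Require Import all_boot all_order all_algebra.
From mathcomp Require Import generic_quotient ring_quotient fraction boolp.
From mathcomp.multinomials Require Import mpoly.
From mathcomp Require Import ring zify.
Require Import Defs.

Set Implicit Arguments.
Unset Strict Implicit.
Unset Printing Implicit Defensive.

Import Order.TTheory GRing.Theory Num.Theory.
Local Open Scope ring_scope.

(** * Forests and monomial ideals *)

(** Betti numbers are defined through an arbitrary graded resolution and depth through arbitrary,
    possibly inhomogeneous sequences, so neither can be read off one chosen minimal resolution. The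
    cone of the comparison map is an exact complex of free modules, bounded on the right, hence
    split; this is why its exactness survives setting the variables to 0. What remains there are
    edge cells (b, U) modulo node cells (a, U). A facet misses (k-1)(d-r) vertices and a gluing
    simplex k(d-r), which gives the two binomials. An edge sits one homological degree below the
    node with the same U, which makes the strand linear, and the incidence map is injective for
    nonempty U, which fixes the sign inside the absolute value. The regular sequence has one term
    more than a gluing simplex has vertices: embedding K[D] modulo e_1, ..., e_j into the sum over
    the facets needs regularity on the gluing simplices for e_1, ..., e_j only, while e_(j+1) then
    has to be regular on the facets alone. So j may go up to r + 1. *)

Section ForestData.
Variable T : finType.

(* The facets are F 0, ..., F k.-1; for 0 < b < k, the set G b spans the
   intersection of the simplex F b with the preceding ones, and par b is the
   index of a preceding facet containing G b. *)
Record forest_data (k d1 r1 : nat) (D : {set {set T}}) (F G : nat -> {set T})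
    (par : nat -> nat) : Prop := ForestData {
  card_facet : forall a, (a < k)%N -> #|F a| = d1;
  card_glue : forall b, (0 < b < k)%N -> #|G b| = r1;
  par_lt : forall b, (0 < b < k)%N -> (par b < b)%N;
  glue_sub : forall b, (0 < b < k)%N -> G b \subset F b;
  glue_par : forall b, (0 < b < k)%N -> G b \subset F (par b);
  glue_cap : forall a b, (a < b)%N -> (b < k)%N -> F a :&: F b \subset G b;
  faceP : forall s : {set T},
    s \in D <-> exists2 a, (a < k)%N & s \subset F a
}.

Lemma in_complex_of (Fs : seq {set T}) (s : {set T}) :
  reflect (exists2 a, (a < size Fs)%N & s \subset nth set0 Fs a)
          (s \in complex_of Fs).
Proof.
rewrite /complex_of; elim: Fs => [|F Fs IH] /=.
  by rewrite big_nil inE; constructor; case.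
rewrite big_cons in_setU powersetE; apply: (iffP orP).
  case=> [sF|/IH[a lta sa]]; first by exists 0%N.
  by exists a.+1.
case=> [[|a] lta sa]; first by left.
by right; apply/IH; exists a.
Qed.

(** Vertex counts [d1] and [r1] replace the dimensions, which may be -1. A parent exists because the
    gluing set is itself a face of the preceding union, hence lies in a single earlier facet. *)
Lemma dr_forest_data (d r : int) k (C : {set {set T}}) :
  (2 <= k)%N -> dr_forest d r k C ->
  exists d1 r1 F G par, [/\ d1%:Z = d + 1, r1%:Z = r + 1, (r1 < d1)%N
    & forest_data k d1 r1 C F G par].
Proof.
move=> k2 [Fs [_ dimF dimG -> [uFs szFs _]]].
pose F a := nth set0 Fs a.
have card_F a : (a < k)%N -> #|F a|%:Z - 1 = d.
  rewrite -szFs => lta; have [E [eqE <-]] := dimF _ (mem_nth set0 lta).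
  suff -> : F a = E by [].
  have EF : E \in powerset (F a) by rewrite eqE powersetE.
  have : F a \in powerset E by rewrite -eqE powersetE.
  by move: EF; rewrite !powersetE => EF FE; apply/eqP; rewrite eqEsubset FE.
have exG b : (0 < b < k)%N -> exists G : {set T}, exists p : nat,
   [/\ complex_of (take b Fs) :&: powerset (F b) = powerset G, #|G|%:Z - 1 = r,
       (p < b)%N & G \subset F p].
  move=> /[dup] bk; rewrite -szFs => /dimG[G [eqG cG]]; exists G.
  have : G \in complex_of (take b Fs) :&: powerset (F b).
    by rewrite eqG powersetE.
  rewrite inE => /andP[/in_complex_of[p ltp sGp] _].
  have ltpb : (p < b)%N.
    by apply: leq_trans ltp _; rewrite size_take; case: ltnP.
  by exists p; split=> //; move: sGp; rewrite nth_take.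
have {exG} /choice[G /choice[par GP]] b : exists G : {set T}, exists p : nat,
  (0 < b < k)%N ->
   [/\ complex_of (take b Fs) :&: powerset (F b) = powerset G, #|G|%:Z - 1 = r,
       (p < b)%N & G \subset F p].
  case: (boolP (0 < b < k)%N) => [/exG[G [p ?]]|]; first by exists G, p.
  by exists set0, 0%N.
have GF b : (0 < b < k)%N -> G b \subset F b.
  move=> /GP[eqG _ _ _]; have : G b \in powerset (G b) by rewrite powersetE.
  by rewrite -eqG inE powersetE => /andP[].
have k0 : (0 < k)%N by apply: leq_trans k2.
have card_Fn a : (a < k)%N -> #|F a| = #|F 0%N|.
  move=> /card_F; rewrite -(card_F _ k0) => /eqP.
  by rewrite (inj_eq (addIr _)) => /eqP[].
have card_Gn b : (0 < b < k)%N -> #|G b| = #|G 1%N|.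
  move=> /GP[_ + _ _]; have [_ <- _ _] := GP 1%N k2.
  by move=> /eqP; rewrite (inj_eq (addIr _)) => /eqP[].
exists #|F 0%N|, #|G 1%N|, F, G, par; split.
- by rewrite -(card_F _ k0) subrK.
- by have [_ <- _ _] := GP 1%N k2; rewrite subrK.
(* Equality of [r1] and [d1] would force [G 1 = F 1] and, as [par 1] is 0, [G 1 = F 0], against the
   distinctness of the facets. *)
- have [_ _ lt1 sG1] := GP 1%N k2.
  rewrite ltn_neqAle -(card_Fn 1%N) // subset_leq_card ?GF // andbT.
  apply/negP => /eqP c1; have p0 : par 1%N = 0%N by case: (par 1%N) lt1.
  have e1 : G 1%N = F 1%N by apply/eqP; rewrite eqEcard GF // c1 leqnn.
  have e0 : G 1%N = F 0%N.
    by apply/eqP; rewrite eqEcard c1 (card_Fn 1%N) // leqnn andbT -/(F 0%N); move: sG1; rewrite p0.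
  have := nth_uniq set0 (s := Fs) (i := 0%N) (j := 1%N).
  by rewrite szFs -/(F 0%N) -/(F 1%N) -e0 e1 eqxx => /(_ k0 k2 uFs).
- split=> //.
  + by move=> b /GP[].
  + by move=> b /GP[].
  + move=> a b ab bk; have b0 : (0 < b < k)%N by rewrite bk (leq_ltn_trans _ ab).
    have [eqG _ _ _] := GP b b0; rewrite -powersetE -eqG inE powersetE subsetIr.
    rewrite andbT; apply/in_complex_of; exists a.
      by rewrite size_take szFs bk.
    by rewrite nth_take // subsetIl.
  + by move=> s; rewrite -szFs; apply: (iff_sym (rwP (in_complex_of Fs s))).
Qed.

End ForestData.

(** * Stanley-Reisner ideals as conditions on coefficients *)

Section MonomialIdeals.
Variables (K : fieldType) (n : nat).
Local Notation S := {mpoly K[n]}.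
Implicit Types (m : 'X_{1..n}) (p q : S) (F s : {set 'I_n})
  (D : {set {set 'I_n}}).

Definition mfilter (Q : pred 'X_{1..n}) p : S :=
  \sum_(m <- msupp p | Q m) p@_m *: 'X_[m].

Lemma mcoeff_mfilter Q p m : (mfilter Q p)@_m = if Q m then p@_m else 0.
Proof.
rewrite /mfilter raddf_sum /= big_mkcond /=.
under eq_bigr => m' _ do rewrite mcoeffZ mcoeffX.
have [mp|mNp] := boolP (m \in msupp p); last first.
  rewrite memN_msupp_eq0 // if_same big_seq big1 // => m' m'p.
  case: ifP => // _; case: eqP => [e|]; last by rewrite mulr0.
  by rewrite -e m'p in mNp.
rewrite (bigD1_seq m) ?msupp_uniq //= eqxx mulr1 big1 ?addr0 // => m' ne.
by rewrite (negbTE ne) mulr0 if_same.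
Qed.

Definition msup m : {set 'I_n} := [set i | m i != 0%N].

Lemma msup0 : msup 0%MM = set0.
Proof. by apply/setP => i; rewrite !inE mnm0E. Qed.

Lemma msupD m1 m2 : msup (m1 + m2)%MM = msup m1 :|: msup m2.
Proof. by apply/setP => i; rewrite !inE mnmDE addn_eq0 negb_and. Qed.

Lemma msupU i : msup U_(i)%MM = [set i].
Proof. by apply/setP => j; rewrite !inE mnm1E eqb0 negbK eq_sym. Qed.

Definition down_closed D := forall s s', s' \in D -> s \subset s' -> s \in D.

Lemma down_closed_powerset F : down_closed (powerset F).
Proof. by move=> s s'; rewrite !powersetE => sF /subset_trans; apply. Qed.

(** The family [D] is arbitrary: an [scomplex] must contain every vertex, but simplices on fewer
    vertices are needed as well. *)
Definition van D p := forall m, msup m \in D -> p@_m = 0.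

Lemma van0 D : van D 0.
Proof. by move=> m _; rewrite mcoeff0. Qed.

Lemma vanD D p q : van D p -> van D q -> van D (p + q).
Proof. by move=> Dp Dq m mD; rewrite mcoeffD Dp ?Dq ?addr0. Qed.

Lemma vanN D p : van D p -> van D (- p).
Proof. by move=> Dp m mD; rewrite mcoeffN Dp ?oppr0. Qed.

Lemma vanB D p q : van D p -> van D q -> van D (p - q).
Proof. by move=> Dp /vanN; apply: vanD. Qed.

Lemma vanM D p q : down_closed D -> van D q -> van D (p * q).
Proof.
move=> dD Dq m mD; rewrite mcoeffM big1 // => -[k l] /= /eqP ekl.
rewrite Dq ?mulr0 //; apply: dD mD _.
by move: (msupD k l); rewrite -ekl => ->; apply: subsetUr.
Qed.

Lemma van_sum D (I : Type) (s : seq I) (P : pred I) (f : I -> S) :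
  (forall i, P i -> van D (f i)) -> van D (\sum_(i <- s | P i) f i).
Proof. by move=> h; elim/big_ind: _ => //; [apply: van0|apply: vanD]. Qed.

Lemma vanU D1 D2 p : van (D1 :|: D2) p <-> van D1 p /\ van D2 p.
Proof.
split=> [h|[h1 h2] m]; last by rewrite inE => /orP[/h1|/h2].
by split=> m mD; apply: h; rewrite inE mD ?orbT.
Qed.

Lemma van_sub D1 D2 p : D1 \subset D2 -> van D2 p -> van D1 p.
Proof. by move=> /subsetP sD h m /sD /h. Qed.

(** The terms of [p] supported outside [D1] form [q]. The others have support in [D1], so by
    hypothesis none of them has support in [D2]. *)
Lemma vanI D1 D2 p : van (D1 :&: D2) p ->
  exists q, exists r, [/\ van D1 q, van D2 r & p = q + r].
Proof.
move=> h; exists (mfilter (fun m => msup m \notin D1) p).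
exists (p - mfilter (fun m => msup m \notin D1) p); split.
- by move=> m mD; rewrite mcoeff_mfilter mD.
- move=> m mD; rewrite mcoeffB mcoeff_mfilter; case: ifPn => [_|].
    by rewrite subrr.
  by rewrite negbK => mD1; rewrite h ?subr0 // inE mD1.
- by rewrite addrC subrK.
Qed.

Lemma vanX F i : i \notin F -> van (powerset F) 'X_i.
Proof.
move=> iF m; rewrite powersetE mcoeffX; case: eqP => // <-.
by rewrite msupU sub1set (negbTE iF).
Qed.

Lemma van_mulX F i p : i \in F ->
  van (powerset F) ('X_i * p) -> van (powerset F) p.
Proof.
move=> iF h m mF; rewrite -(mcoeffMX p U_(i)%MM m) mulrC; apply: h.
by rewrite powersetE msupD subUset msupU sub1set iF -powersetE.
Qed.

(** Each monomial that occurs contains a variable outside [F], and one such variable is divided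
    out. *)
Lemma van_gen F p : van (powerset F) p ->
  exists c : 'I_n -> S, p = \sum_(i | i \notin F) 'X_i * c i.
Proof.
move=> Fp; pose P q := exists c : 'I_n -> S, q = \sum_(i | i \notin F) 'X_i * c i.
rewrite -/(P p) [p]mpolyE big_seq; elim/big_ind: _.
- by exists (fun=> 0); rewrite big1 // => i _; rewrite mulr0.
- move=> q q' [c ->] [c' ->]; exists (fun i => c i + c' i).
  by rewrite -big_split; apply: eq_bigr => i _; rewrite mulrDr.
move=> m; rewrite mcoeff_msupp => pm.
have : ~~ (msup m \subset F).
  by apply: contraNN pm => mF; rewrite Fp // powersetE.
case/subsetPn => i mi iF.
exists (fun j => if j == i then p@_m *: 'X_[m - U_(i)] else 0).
rewrite (bigD1 i) //= eqxx big1 ?addr0; last first.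
  by move=> j /andP[_ /negbTE ->]; rewrite mulr0.
rewrite -scalerAr -mpolyXD addmC submK //; apply/mnm_lepP => j.
by rewrite mnm1E; case: eqP => // <-; rewrite lt0n; move: mi; rewrite inE.
Qed.

Lemma msup_mesym1 s : msup (mesym1 s) = s.
Proof. by apply/setP => i; rewrite inE mnmE; case: (i \in s). Qed.

Lemma sqfree_monE s : sqfree_mon K s = 'X_[mesym1 s].
Proof.
rewrite /sqfree_mon mprodXE; congr 'X_[_]; apply/mnmP => i.
rewrite mnm_sumE mnmE; under eq_bigr => j _ do rewrite mnm1E.
case: (boolP (i \in s)) => [si|siN].
  rewrite (bigD1 i) //= eqxx big1 // => j /andP[_ /negbTE nji].
  by rewrite nji.
rewrite big1 // => j sj; case: eqP => // e.
by rewrite -e sj in siN.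
Qed.

Lemma van_SR (D : scomplex n) p : SR_ideal D p <-> van D p.
Proof.
split.
  move=> /asboolP[c ->]; apply: van_sum => s sD.
  apply: vanM => [s1 s2|m mD]; first exact: sub_face.
  rewrite sqfree_monE mcoeffX; case: eqP => // e.
  by rewrite -e msup_mesym1 (negbTE sD) in mD.
move=> Dp; rewrite [p]mpolyE big_seq.
elim/big_ind: _ => [|q q' /asboolP[c ->] /asboolP[c' ->]|m].
- by apply/asboolP; exists (fun=> 0); rewrite big1 // => i _; rewrite mul0r.
- apply/asboolP; exists (fun i => c i + c' i).
  by rewrite -big_split; apply: eq_bigr => i _; rewrite mulrDl.
rewrite mcoeff_msupp => pm; apply/asboolP.
have mD : msup m \notin faces D by apply: contraNN pm => /Dp ->.
exists (fun s => if s == msup m then p@_m *: 'X_[m - mesym1 (msup m)] else 0).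
rewrite (bigD1 (msup m)) //= eqxx big1 ?addr0; last first.
  by move=> j /andP[_ /negbTE ->]; rewrite mul0r.
rewrite sqfree_monE -scalerAl -mpolyXD submK //; apply/mnm_lepP => j.
by rewrite mnmE inE; case: (m j).
Qed.

Lemma SR_pi_eq0 (D : scomplex n) p : SR_pi D p = 0 <-> van D p.
Proof.
rewrite -van_SR -(rmorph0 (SR_pi D)) /SR_pi; split.
  by move=> /eqP; rewrite /= -Quotient.idealrBE subr0.
by move=> h; apply/eqP; rewrite /= -Quotient.idealrBE subr0.
Qed.

Lemma SR_pi_surj (D : scomplex n) (a : SR_ring K D) : exists p, a = SR_pi D p.
Proof. by exists (generic_quotient.repr a); rewrite /SR_pi reprK. Qed.

End MonomialIdeals.

(** * Koszul complexes *)

Section InIdeal.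
Variable A : comNzRingType.
Implicit Types (s : seq A) (x y : A).

Lemma in_ideal0 s : in_ideal s 0.
Proof. by exists (fun=> 0); rewrite big1 // => i _; rewrite mul0r. Qed.

Lemma in_idealD s x y : in_ideal s x -> in_ideal s y -> in_ideal s (x + y).
Proof.
move=> [c ->] [e ->]; exists (fun i => c i + e i).
by rewrite -big_split; apply: eq_bigr => i _; rewrite mulrDl.
Qed.

Lemma in_idealM s x y : in_ideal s y -> in_ideal s (x * y).
Proof.
move=> [c ->]; exists (fun i => x * c i).
by rewrite mulr_sumr; apply: eq_bigr => i _; rewrite mulrA.
Qed.

Lemma in_idealN s x : in_ideal s x -> in_ideal s (- x).
Proof. by rewrite -mulN1r; apply: in_idealM. Qed.

Lemma in_ideal_sum s (I : Type) (r : seq I) (P : pred I) (f : I -> A) :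
  (forall i, P i -> in_ideal s (f i)) -> in_ideal s (\sum_(i <- r | P i) f i).
Proof.
by move=> h; elim/big_ind: _ => //; [apply: in_ideal0|apply: in_idealD].
Qed.

Lemma in_ideal_rcons s y x :
  in_ideal (rcons s y) x <-> exists a, exists2 c, in_ideal s a & x = a + c * y.
Proof.
split.
  move=> [c ->]; rewrite size_rcons big_ord_recr /=.
  exists (\sum_(i < size s) c i * s`_i), (c (size s)).
    by exists c.
  rewrite nth_rcons ltnn eqxx; congr (_ + _); apply: eq_bigr => i _.
  by rewrite nth_rcons ltn_ord.
move=> [_ [c [e ->] ->]]; exists (fun i => if (i < size s)%N then e i else c).
rewrite size_rcons big_ord_recr /= ltnn nth_rcons ltnn eqxx; congr (_ + _).
by apply: eq_bigr => i _; rewrite ltn_ord nth_rcons ltn_ord.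
Qed.

Lemma in_ideal_take s i x : (i < size s)%N ->
  in_ideal (take i.+1 s) x <->
  exists a, exists2 c, in_ideal (take i s) a & x = a + c * s`_i.
Proof. by move=> lti; rewrite (take_nth 0) // in_ideal_rcons. Qed.

Lemma in_ideal_nil x : in_ideal [::] x <-> x = 0.
Proof.
split=> [[c ->]|->]; first by rewrite big_ord0.
exact: in_ideal0.
Qed.

End InIdeal.

Section Koszul.
Variables (n : nat) (A : comNzRingType) (x : 'I_n -> A).
Implicit Types (i j : 'I_n) (U V : {set 'I_n}) (c : {set 'I_n} -> A).

(** The sign of moving e_i to its place in the exterior product with e_U. *)
Definition ksg i U : A := (-1) ^+ #|[set j in U | (j < i)%N]|.

Lemma ksgU i j U : j \notin U -> ksg i (j |: U) = (-1) ^+ (j < i)%N * ksg i U.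
Proof.
move=> jU; rewrite /ksg -exprD; congr (_ ^+ _); case: ltnP => ji /=.
  have -> : [set k in j |: U | (k < i)%N] = j |: [set k in U | (k < i)%N].
    by apply/setP => k; rewrite !inE andb_orl; case: eqP => // ->; rewrite ji.
  by rewrite cardsU1 inE (negbTE jU).
congr #|pred_of_set _|; apply/setP => k; rewrite !inE andb_orl; case: eqP => //= ->.
by rewrite ltnNge ji (negbTE jU).
Qed.

Lemma ksgD1 i j U : j \in U -> ksg i U = (-1) ^+ (j < i)%N * ksg i (U :\ j).
Proof. by move=> jU; rewrite -ksgU ?setD1K // !inE eqxx. Qed.

Lemma ksgii i U : ksg i (i |: U) = ksg i U.
Proof.
case: (boolP (i \in U)) => iU; first by rewrite (setUidPr _) ?sub1set.
by rewrite ksgU // ltnn expr0 mul1r.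
Qed.

Lemma ksg_sq i U : ksg i U * ksg i U = 1.
Proof. by rewrite /ksg -exprD addnn -mul2n exprM sqrrN expr1n expr1n. Qed.

Lemma ksg_anti i j U : i != j -> i \notin U -> j \notin U ->
  ksg i U * ksg j (i |: U) = - (ksg j U * ksg i (j |: U)).
Proof.
move=> ij iU jU; rewrite !ksgU //; move: ij; rewrite -val_eqE /=.
by case: ltngtP => //= _ _; rewrite expr0 expr1 ?mul1r ?mulN1r ?mulrN ?opprK mulrC.
Qed.

(* The Koszul differential, on chains written as functions on exterior
   monomials e_U. *)
Definition kd c U : A := \sum_(i | i \notin U) ksg i U * x i * c (i |: U).

(** The pairs with i < j are matched with those with j < i; there is no division by 2, so the
    characteristic is arbitrary. *)
Lemma antisym_sum0 (P : pred 'I_n) (f : 'I_n -> 'I_n -> A) :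
  (forall i j, P i -> P j -> i != j -> f i j = - f j i) ->
  \sum_(i | P i) \sum_(j | P j && (j != i)) f i j = 0.
Proof.
move=> fN; rewrite pair_big_dep /=.
rewrite (bigID (fun p : 'I_n * 'I_n => (p.1 < p.2)%N)) /=.
rewrite [X in _ + X](reindex_inj (h := fun p => (p.2, p.1))) /=; last first.
  by move=> [a b] [c d] /= [-> ->].
rewrite [X in X + _](eq_bigr (fun p => - f p.2 p.1)); last first.
  move=> [a b] /= /andP[/and3P[Pa Pb ba] _]; apply: fN => //.
  by rewrite eq_sym.
rewrite sumrN [X in _ + X](eq_bigl (fun p : 'I_n * 'I_n =>
  [&& P p.1, P p.2 & p.2 != p.1] && (p.1 < p.2)%N)) ?addNr // => -[a b] /=.
case: (P a) (P b) => [] [] //=; rewrite [a == b]eq_sym -leqNgt leq_eqVlt.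
by rewrite -val_eqE /=; case: ltngtP.
Qed.

Lemma kdd c U : kd (kd c) U = 0.
Proof.
rewrite /kd.
rewrite -[RHS](antisym_sum0 (P := fun i => i \notin U)
  (f := fun i j => ksg i U * ksg j (i |: U) * (x i * x j) * c (j |: (i |: U)))).
  apply: eq_bigr => i iU; rewrite mulr_sumr; apply: eq_big => j.
    by rewrite in_setU1 negb_or andbC.
  by move=> _; rewrite !mulrA; congr (_ * _); rewrite -!mulrA; congr (_ * _);
    rewrite mulrCA.
move=> i j iU jU ij; rewrite ksg_anti // !mulNr [x j * _]mulrC.
by rewrite [i |: (j |: U)]setUCA.
Qed.

Lemma eq_kd c c' : c =1 c' -> kd c =1 kd c'.
Proof. by move=> e U; apply: eq_bigr => i _; rewrite e. Qed.

Lemma kdD c c' U : kd (fun V => c V + c' V) U = kd c U + kd c' U.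
Proof. by rewrite -big_split; apply: eq_bigr => i _; rewrite mulrDr. Qed.

Lemma kdZ a c U : kd (fun V => a * c V) U = a * kd c U.
Proof. by rewrite mulr_sumr; apply: eq_bigr => i _; rewrite mulrCA. Qed.

Lemma kd0 U : kd (fun=> 0) U = 0.
Proof. by rewrite /kd big1 // => i _; rewrite mulr0. Qed.

(** Exterior multiplication by the sum of the a_i e_i, on coefficient functions. *)
Definition kh (a : 'I_n -> A) c U : A :=
  \sum_(i in U) ksg i U * a i * c (U :\ i).

(** Removing and inserting the same index gives the scalar; the mixed terms cancel by sign. A single
    variable serves the exactness proof, an arbitrary element of the ideal the depth bound. *)
Lemma kd_kh a c U :
  kd (kh a c) U + kh a (kd c) U = (\sum_i a i * x i) * c U.
Proof.
pose f i j := ksg i U * ksg j (i |: U) * x i * a j * c ((i |: U) :\ j).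
have -> : kd (kh a c) U = \sum_(i | i \notin U) a i * x i * c U +
    \sum_(i | i \notin U) \sum_(j | j \in U) f i j.
  rewrite -big_split; apply: eq_bigr => i iU /=; rewrite /kh mulr_sumr.
  rewrite (bigD1 i) ?setU11 //= setU1K // ksgii; congr (_ + _).
    rewrite -mulrA [x i * _]mulrA mulrA [x i * _]mulrCA !mulrA ksg_sq mul1r.
    by rewrite [x i * _]mulrC.
  apply: eq_big => j; last by move=> _; rewrite /f !mulrA; congr (_ * _ * _); rewrite mulrAC.
  rewrite in_setU1; case: eqP => [->|_] //=; last by rewrite andbT.
  by rewrite (negbTE iU).
have -> : kh a (kd c) U = \sum_(i | i \in U) a i * x i * c U -
    \sum_(i | i \notin U) \sum_(j | j \in U) f i j.
  rewrite exchange_big -sumrN -big_split; apply: eq_bigr => j jU /=.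
  rewrite /kd mulr_sumr (bigD1 j) /=; last by rewrite !inE eqxx.
  rewrite setD1K // -(ksgii j (U :\ j)) setD1K //; congr (_ + _).
    rewrite !mulrA -[_ * a j * _]mulrA [a j * _]mulrC mulrA ksg_sq mul1r.
    by rewrite [a j * _]mulrC.
  rewrite -sumrN; apply: eq_big => i; last first.
    rewrite !inE negb_and negbK => /andP[/predU1P[->|iU] ij].
      by rewrite eqxx in ij.
    have -> : i |: (U :\ j) = (i |: U) :\ j.
      apply/setP => k; rewrite !inE; case: (eqVneq k i) => [->|//].
      by rewrite ij.
    rewrite /f mulrA -!mulNr; congr (_ * _).
    rewrite !mulrA [_ * a j * _]mulrAC [LHS]mulrAC; congr (_ * _ * _).
    rewrite [ksg j (i |: U)]ksgU // (ksgD1 i jU).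
    move: ij; rewrite -val_eqE /=; case: ltngtP => //= _ _;
      by rewrite expr0 expr1 ?mul1r ?mulN1r ?mulrN ?mulNr ?opprK mulrC.
  rewrite !inE negb_and negbK; case: (eqVneq i j) => [->|_] //=; last by rewrite andbT.
  by rewrite jU.
rewrite addrACA subrr addr0 addrC mulr_suml [RHS](bigID (mem U)) /=.
by congr (_ + _); apply: eq_bigl.
Qed.

End Koszul.

(** * Exactness of the Koszul complexes on subsets of the variables *)

Section KoszulExact.
Variables (K : fieldType) (n : nat).
Local Notation S := {mpoly K[n]}.
Local Notation X := (fun i : 'I_n => 'X_i : S).
Implicit Types (U V F : {set 'I_n}) (c : {set 'I_n} -> S).

(** The degree [q] chains of the Koszul complex on the variables of [V], taken among the chains on
    all variables so that one differential serves every [V]. *)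
Definition ksupp V q c := forall U, ~~ ((U \subset V) && (#|U| == q)) -> c U = 0.

Lemma ksupp_kd V q c : ksupp V q.+1 c -> ksupp V q (kd X c).
Proof.
move=> h U UN; rewrite /kd big1 // => i iU; rewrite h ?mulr0 //.
rewrite cardsU1 iU add1n eqSS subUset; apply: contraNN UN.
by move=> /andP[/andP[_ ->] ->].
Qed.

Lemma ksuppD V q c c' : ksupp V q c -> ksupp V q c' ->
  ksupp V q (fun U => c U + c' U).
Proof. by move=> h h' U UN; rewrite h ?h' ?addr0. Qed.

Lemma ksuppZ V q a c : ksupp V q c -> ksupp V q (fun U => a * c U).
Proof. by move=> h U UN; rewrite h ?mulr0. Qed.

Lemma ksuppN V q c : ksupp V q c -> ksupp V q (fun U => - c U).
Proof. by move=> h U UN; rewrite h ?oppr0. Qed.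

Lemma ksupp_sub V V' q c : V \subset V' -> ksupp V q c -> ksupp V' q c.
Proof.
move=> sV h U UN; apply: h; apply: contraNN UN => /andP[UV ->].
by rewrite (subset_trans UV).
Qed.

Lemma van_kd F c : ksupp (~: F) 1 c -> van (powerset F) (kd X c set0).
Proof.
move=> h; rewrite /kd; apply: van_sum => i _.
have [iF|iF] := boolP (i \in F).
  by rewrite h ?mulr0; [apply: van0|rewrite setU0 sub1set inE iF].
rewrite mulrC mulrA; apply: vanM; first exact: down_closed_powerset.
exact: vanX.
Qed.

Lemma koszul_exact0 F c : ksupp (~: F) 0 c -> van (powerset F) (c set0) ->
  exists2 c', ksupp (~: F) 1 c' & c =1 kd X c'.
Proof.
move=> h /van_gen[e ce].
pose c' U : S := \sum_(i | i \notin F) (U == [set i])%:R * e i.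
exists c'.
  move=> U UN; rewrite /c' big1 // => i iF; case: (U =P [set i]) UN => [->|]; rewrite ?mul0r //.
  by rewrite cards1 sub1set inE iF.
move=> U; have [->|[j jU]] := set_0Vmem U; last first.
  rewrite h; last first.
    by rewrite cards_eq0 -[U == _]negbK; apply/nandP; right; apply/negPn/set0Pn; exists j.
  rewrite /kd big1 // => i iU; rewrite /c' big1 ?mulr0 // => l lF.
  case: eqP => [e1|]; rewrite ?mul0r //.
  have : i \in [set l] by rewrite -e1 setU11.
  have : j \in [set l] by rewrite -e1 setU1r.
  by rewrite !inE => /eqP <- /eqP eij; rewrite eij jU in iU.
rewrite ce /kd big_mkcond /=; apply: eq_big => [i|i _]; first by rewrite inE.
rewrite /c' setU0 /ksg (_ : [set _ in _ | _] = set0) ?cards0 ?expr0 ?mul1r; last first.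
  by apply/setP => j; rewrite !inE.
case: ifPn => iF.
  rewrite (bigD1 i) //= eqxx mul1r big1 ?addr0 // => j /andP[_ ji].
  by rewrite (inj_eq set1_inj) eq_sym (negbTE ji) mul0r.
rewrite big1 ?mulr0 // => j jF; rewrite (inj_eq set1_inj).
case: (eqVneq i j) jF iF => [->|ne] jF; first by rewrite jF.
by rewrite mul0r.
Qed.

(** Induction on V: for v in V write c = c0 + e_v c1. The cycle condition says that c1 is a cycle
    and d c0 = - x_v c1. If c1 = d b1, then c0 + x_v b1 is a cycle on fewer variables, hence some d
    b0, and c = d (b0 - e_v b1). *)
Lemma koszul_exact V q c : ksupp V q.+1 c -> kd X c =1 (fun=> 0) ->
  exists2 c', ksupp V q.+2 c' & c =1 kd X c'.
Proof.
have [N] := ubnP #|V|; elim: N => // N IH in V q c *; rewrite ltnS => VN cV dc.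
have [V0|[v vV]] := set_0Vmem V.
  exists (fun=> 0); first by move=> U _.
  move=> U; rewrite kd0 cV // V0 subset0.
  by case: eqP => // ->; rewrite cards0.
pose V' := V :\ v.
have ltV' : (#|V'| < N)%N by move: VN; rewrite (cardsD1 v V) vV.
pose a (i : 'I_n) : S := (i == v)%:R.
have sa : \sum_i a i * 'X_i = 'X_v.
  rewrite (bigD1 v) //= /a eqxx mul1r big1 ?addr0 // => i /negbTE ->.
  by rewrite mul0r.
have khE b U : kh a b U = if v \in U then ksg S v U * b (U :\ v) else 0.
  rewrite /kh; case: ifPn => vU.
    rewrite (bigD1 v) //= /a eqxx mulr1 big1 ?addr0 // => i /andP[_ /negbTE ->].
    by rewrite mulr0 mul0r.
  rewrite big1 // => i iU; rewrite /a; case: eqP => [e|]; last by rewrite mulr0 mul0r.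
  by rewrite -e iU in vU.
pose c0 U : S := if v \in U then 0 else c U.
pose c1 U : S := if v \in U then 0 else ksg S v U * c (v |: U).
have cE U : c U = c0 U + kh a c1 U.
  rewrite khE /c0 /c1; case: ifPn => vU; last by rewrite addr0.
  rewrite setD11 add0r setD1K // mulrA -[ksg S v (U :\ v)]ksgii setD1K //.
  by rewrite ksg_sq mul1r.
have c0V : ksupp V' q.+1 c0.
  move=> U UN; rewrite /c0; case: ifPn => // vU; apply: cV.
  by apply: contraNN UN => /andP[UV ->]; rewrite subsetD1 UV vU.
have c1V : ksupp V' q c1.
  move=> U UN; rewrite /c1; case: ifPn => // vU; rewrite cV ?mulr0 //.
  apply: contraNN UN; rewrite cardsU1 vU add1n eqSS subUset => /andP[/andP[_ UV] ->].
  by rewrite subsetD1 UV vU.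
have suppv q' b U : ksupp V' q' b -> v \in U -> b U = 0.
  by move=> h vU; apply: h; rewrite subsetD1 vU andbF.
have dcE U : kd X c0 U + 'X_v * c1 U - kh a (kd X c1) U = 0.
  rewrite -(dc U) (eq_kd _ cE) kdD -sa -(kd_kh X a c1 U).
  by rewrite -addrA addrK.
have c1U : forall U, v \notin U -> kd X c0 U + 'X_v * c1 U = 0.
  by move=> U vU; have := dcE U; rewrite khE (negbTE vU) subr0.
have suppdc0 U : v \in U -> kd X c0 U = 0.
  by move=> vU; apply: (suppv q) => //; apply: ksupp_kd.
have dc1 : kd X c1 =1 (fun=> 0).
  move=> U; have [vU|vU] := boolP (v \in U).
    rewrite /kd big1 // => i iU; rewrite (suppv q _ _ c1V) ?mulr0 //.
    by rewrite setU1r.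
  have := dcE (v |: U); rewrite khE setU11 setU1K // suppdc0 ?setU11 //.
  rewrite (suppv q _ _ c1V) ?setU11 // mulr0 addr0 sub0r => /eqP.
  rewrite oppr_eq0 => /eqP e; rewrite -[LHS]mul1r -(ksg_sq S v (v |: U)).
  by rewrite -mulrA e mulr0.
have [b1 b1V c1E] : exists2 b1, ksupp V' q.+1 b1 & c1 =1 kd X b1.
  (* For q = 0 the chain c1 sits in degree 0, where cycles need not bound. But x_v c1 lies in the
     ideal of the other variables of V, and x_v is regular modulo that ideal. *)
  case: q cV c0V c1V suppdc0 => [|q] cV c0V c1V suppdc0; last exact: IH.
  have := c1V; rewrite -[V']setCK => c1C; apply: koszul_exact0 => //.
  apply: (@van_mulX _ _ _ v); first by rewrite !inE eqxx.
  have := c1U set0; rewrite in_set0 => /(_ isT) /eqP; rewrite addrC.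
  rewrite addr_eq0 => /eqP ->; apply: vanN.
  by apply: van_kd; rewrite setCK.
have [b0 b0V b0E] : exists2 b0, ksupp V' q.+2 b0 &
    (fun U => c0 U + 'X_v * b1 U) =1 kd X b0.
  apply: IH => //; first by apply: ksuppD => //; apply: ksuppZ.
  move=> U; rewrite kdD kdZ -c1E; have [vU|/c1U //] := boolP (v \in U).
  by rewrite suppdc0 // (suppv q) // mulr0 addr0.
exists (fun U => b0 U - kh a b1 U).
  apply: ksuppD; first by apply: ksupp_sub b0V; apply: subD1set.
  apply: ksuppN => U UN; rewrite khE; case: ifPn => // vU.
  rewrite b1V ?mulr0 //; apply: contraNN UN => /andP[UV cU].
  by rewrite -(setD1K vU) subUset sub1set vV (subset_trans UV (subD1set _ _)) /=
    cardsU1 setD11 add1n eqSS.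
move=> U; rewrite kdD -b0E (eq_kd _ (c' := fun U => -1 * kh a b1 U)); last first.
  by move=> W; rewrite mulN1r.
rewrite kdZ mulN1r -sa -kd_kh [kd _ (kh _ _) U + _]addrC !addrA addrK cE.
by congr (_ + _); rewrite !khE; case: ifP => // _; rewrite c1E.
Qed.

End KoszulExact.

(** * The gluing complex *)

Section GluingComplex.
Variables (n k : nat) (F G : 'I_k -> {set 'I_n}) (P : 'I_k -> 'I_k).
Hypothesis Plt : forall b : 'I_k, (0 < b)%N -> (P b < b)%N.
Hypothesis GF : forall b : 'I_k, (0 < b)%N -> G b \subset F b.
Hypothesis GP : forall b : 'I_k, (0 < b)%N -> G b \subset F (P b).
Hypothesis capG : forall a b : 'I_k, (a < b)%N -> F a :&: F b \subset G b.

(* The basis elements (false, a, U) span the Koszul complexes resolving the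
   K[F a], the (true, b, U) with b > 0 those resolving the K[G b]. *)
Definition gidx : Type := (bool * 'I_k * {set 'I_n})%type.
HB.instance Definition _ := Finite.on gidx.

(* (false, a, U) sits in homological degree #|U|.+1 and (true, b, U) in degree
   #|U|, so that K[D] is the homology in degree 1. *)
Definition gvalid i : pred gidx := fun t =>
  if t.1.1 then [&& #|t.2| == i, (0 < t.1.2)%N & t.2 \subset ~: G t.1.2]
  else (#|t.2|.+1 == i) && (t.2 \subset ~: F t.1.2).

Section AnyRing.
Variables (A : comNzRingType) (x : 'I_n -> A).
Implicit Types (f g : gidx -> A).

(** The cone of the incidence map: the edge b receives the difference of the values at its two ends,
    b and its parent, and the Koszul differential with the opposite sign, so that the square is 0.
    The index 0 is the root and has no edge. *)
Definition gD f (t : gidx) : A :=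
  if t.1.1 then
    if (0 < t.1.2)%N then
      f (false, t.1.2, t.2) - f (false, P t.1.2, t.2)
      - kd x (fun V => f (true, t.1.2, V)) t.2
    else 0
  else kd x (fun V => f (false, t.1.2, V)) t.2.

Definition gsupp i f := forall t, ~~ gvalid i t -> f t = 0.

Lemma gD0 t : gD (fun=> 0) t = 0.
Proof. by rewrite /gD !kd0 !subr0 !if_same. Qed.

Lemma gDD f g t : gD (fun s => f s + g s) t = gD f t + gD g t.
Proof.
rewrite /gD !kdD; case: ifP => // _; case: ifP => // _; last by rewrite addr0.
by rewrite [RHS]addrACA -opprD; congr (_ - _); rewrite [RHS]addrACA opprD.
Qed.

Lemma gDZ a f t : gD (fun s => a * f s) t = a * gD f t.
Proof.
rewrite /gD !kdZ; case: ifP => // _; case: ifP => // _; last by rewrite mulr0.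
by rewrite !mulrBr.
Qed.

Lemma eq_gD f g : f =1 g -> gD f =1 gD g.
Proof.
move=> e t; have ek b a : kd x (fun V => f (b, a, V)) =1 kd x (fun V => g (b, a, V)).
  by apply: eq_kd.
by rewrite /gD !e !ek.
Qed.

Lemma gD_sum (I : finType) (p : pred I) (f : I -> gidx -> A) t :
  gD (fun s => \sum_(i | p i) f i s) t = \sum_(i | p i) gD (f i) t.
Proof.
elim: (index_enum I) => [|i r IH].
  by rewrite big_nil (@eq_gD _ (fun=> 0)) ?gD0 // => s; rewrite big_nil.
rewrite big_cons -IH; case: ifP => pi; last first.
  by apply: eq_gD => s; rewrite big_cons pi.
by rewrite -gDD; apply: eq_gD => s; rewrite big_cons pi.
Qed.

Lemma gD_gD f t : gD (gD f) t = 0.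
Proof.
case: t => -[[] a] U; last by rewrite /gD /= kdd.
have [a0|a0] := boolP (0 < a)%N; last by rewrite /gD /= (negbTE a0).
have e : kd x (fun V => gD f (true, a, V)) U =
    kd x (fun V => (f (false, a, V) + -1 * f (false, P a, V))
                   + -1 * kd x (fun W => f (true, a, W)) V) U.
  by apply: eq_kd => V; rewrite /gD /= a0 !mulN1r.
rewrite {1}/gD /= a0 e.
by rewrite !kdD !kdZ kdd !mulN1r oppr0 addr0 subrr.
Qed.

Lemma gD_supp i f : gsupp i.+1 f -> gsupp i (gD f).
Proof.
move=> h [[[] a] U]; rewrite /gvalid /gD /= => v.
  case: ifP => // a0; rewrite a0 /= in v.
  rewrite !h /gvalid /= ?subrr ?sub0r.
  - rewrite /kd big1 ?oppr0 // => j jU; rewrite h ?mulr0 // /gvalid /= a0 /=.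
    rewrite cardsU1 jU add1n eqSS; apply: contraNN v => /andP[-> /=].
    by rewrite subUset => /andP[].
  - rewrite eqSS; apply: contraNN v => /andP[-> /= /subset_trans]; apply.
    by rewrite setCS GP.
  - rewrite eqSS; apply: contraNN v => /andP[-> /= /subset_trans]; apply.
    by rewrite setCS GF.
rewrite /kd big1 // => j jU; rewrite h ?mulr0 // /gvalid /=.
rewrite cardsU1 jU add1n eqSS; apply: contraNN v => /andP[-> /=].
by rewrite subUset => /andP[].
Qed.

End AnyRing.

Lemma gD_mcoeff0 (K : fieldType) (f : gidx -> {mpoly K[n]}) t :
  (gD (fun i => 'X_i) f t)@_0%MM = gD (fun=> 0) (fun s => (f s)@_0%MM) t.
Proof.
have kd_mc0 c U : (kd (fun i => 'X_i : {mpoly K[n]}) c U)@_0%MM = 0.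
  rewrite /kd raddf_sum big1 //= => i _; rewrite -mulrA mulrCA rmorphM /=.
  by rewrite mcoeffX mnm1_eq0 mul0r.
rewrite /gD; case: ifP => _; last first.
  by rewrite kd_mc0 /kd big1 // => i _; rewrite mulr0 mul0r.
case: ifP => _; last by rewrite mcoeff0.
rewrite !mcoeffB kd_mc0; congr (_ - _).
by rewrite /kd big1 // => i _; rewrite mulr0 mul0r.
Qed.

Lemma tree_ind (Q : 'I_k -> Prop) :
  (forall b : 'I_k, (forall a : 'I_k, (a < b)%N -> Q a) -> Q b) -> forall b, Q b.
Proof.
move=> h b; have [N] := ubnP (val b); elim: N b => // N IH b.
by rewrite ltnS => bN; apply: h => a ab; apply: IH; apply: leq_trans bN.
Qed.

(** The equations are solved in increasing order of b, each with one new unknown. This underlies the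
    surjectivity onto the sum of the K[G_b]. *)
Lemma tree_primitive (A : zmodType) (w : 'I_k -> A) :
  exists u : 'I_k -> A, forall b : 'I_k, (0 < b)%N -> u b - u (P b) = w b.
Proof.
suff h m : (m <= k)%N -> exists u : 'I_k -> A, forall b : 'I_k, (0 < b < m)%N ->
    u b - u (P b) = w b.
  have [u uP] := h k (leqnn k); exists u => b b0; apply: uP.
  by rewrite b0 ltn_ord.
elim: m => [|m IH] mk.
  by exists (fun=> 0) => b; rewrite ltn0 andbF.
have [u uP] := IH (ltnW mk); pose M := Ordinal mk.
exists (fun b => if b == M then u (P M) + w M else u b) => b /andP[b0].
rewrite ltnS leq_eqVlt => /predU1P[bm|bm].
  have eM : b = M by apply: val_inj.
  have ltM : (P M < m)%N by apply: (Plt (b := M)); rewrite /= -bm.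
  have neM : (P M == M) = false by apply/eqP => e; rewrite {1}e ltnn in ltM.
  by rewrite eM eqxx neM addrAC subrr add0r.
have ne (c : 'I_k) : (c < m)%N -> (c == M) = false.
  by move=> ltc; apply/eqP => e; rewrite e ltnn in ltc.
by rewrite !ne ?uP ?b0 // (ltn_trans (Plt b0)).
Qed.

Section OverField.
Variable K : fieldType.
Local Notation S := {mpoly K[n]}.
Local Notation X := (fun i : 'I_n => 'X_i : S).

(** Facets are added one at a time. As p agrees with u on the parent, p - u_M vanishes on G_M, hence
    on the intersection of F_M with the earlier facets. By [vanI] it is q + r with q vanishing on
    the earlier facets and r on F_M, and p - q is the corrected section. *)
Lemma glue_sections (u : 'I_k -> S) :
  (forall b : 'I_k, (0 < b)%N -> van (powerset (G b)) (u b - u (P b))) ->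
  exists p : S, forall a, van (powerset (F a)) (p - u a).
Proof.
move=> h; suff H m : (m <= k)%N -> exists p : S, forall a : 'I_k, (a < m)%N ->
    van (powerset (F a)) (p - u a).
  by have [p pP] := H k (leqnn k); exists p => a; apply: pP.
elim: m => [|m IH] mk; first by exists 0.
have [p pP] := IH (ltnW mk); pose M := Ordinal mk.
have [m0|m0] := posnP m.
  exists (u M) => a; rewrite m0 ltnS leqn0 => /eqP a0.
  have -> : a = M by apply: val_inj; rewrite /= m0.
  by rewrite subrr; apply: van0.
pose D : {set {set 'I_n}} := \bigcup_(a < k | (a < m)%N) powerset (F a).
have : van (D :&: powerset (F M)) (p - u M).
  apply: (@van_sub _ _ _ (powerset (G M))).
    apply/subsetP => s; rewrite inE !powersetE => /andP[/bigcupP[a am]].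
    rewrite powersetE => sa sM; apply: subset_trans (capG (b := M) am).
    by rewrite subsetI sa.
  have -> : p - u M = (p - u (P M)) - (u M - u (P M)).
    by rewrite opprB addrA subrK.
  apply: vanB; last exact: h.
  apply: (van_sub _ (pP (P M) (@Plt M m0))).
  by rewrite powersetS GP.
case/vanI => q [r [Dq Mr e]]; exists (p - q) => a.
rewrite ltnS leq_eqVlt => /predU1P[am|am].
  have -> : a = M by apply: val_inj.
  by have -> : p - q - u M = r by rewrite addrAC e addrC addKr.
rewrite addrAC; apply: vanB; first exact: pP.
apply: (van_sub _ Dq); apply/subsetP => s sF; apply/bigcupP; by exists a.
Qed.

(** Once the node part of f is lifted to u, the discrepancy [ph] on each edge is a Koszul cycle of
    positive degree, hence a boundary. *)
Lemma gexact_aux i (f u : gidx -> S) : gsupp i.+1 f -> gD X f =1 (fun=> 0) ->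
  (forall t, ~~ (~~ t.1.1 && (gvalid i.+2 t)) -> u t = 0) ->
  (forall a U, f (false, a, U) = kd X (fun V => u (false, a, V)) U) ->
  exists2 g, gsupp i.+2 g & f =1 gD X g.
Proof.
move=> sf df su ue.
pose ph (b : 'I_k) U : S := u (false, b, U) - u (false, P b, U) - f (true, b, U).
have uval a (U : {set 'I_n}) : ~~ ((#|U|.+1 == i.+2) && (U \subset ~: F a)) -> u (false, a, U) = 0.
  by move=> h; apply: su; rewrite /= /gvalid /=.
have /choice[w wP] (b : 'I_k) : exists w : {set 'I_n} -> S, (0 < b)%N ->
    ksupp (~: G b) i.+2 w /\ ph b =1 kd X w.
  have [b0|b0] := boolP (0 < b)%N; last by exists (fun=> 0).
  have [//||w ? ?] := @koszul_exact K n (~: G b) i (ph b); last by exists w.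
    move=> U UN; rewrite /ph !uval ?sf ?subr0 //.
    - by rewrite /gvalid /= b0 /= andbC.
    - rewrite eqSS; apply: contraNN UN => /andP[-> /subset_trans->] //.
      by rewrite setCS GP.
    - rewrite eqSS; apply: contraNN UN => /andP[-> /subset_trans->] //.
      by rewrite setCS GF.
  move=> U; rewrite (eq_kd _ (c' := fun V => (u (false, b, V) +
     -1 * u (false, P b, V)) + -1 * f (true, b, V))); last first.
    by move=> V; rewrite !mulN1r.
  rewrite !kdD !kdZ -!ue !mulN1r.
  by have := df (true, b, U); rewrite /gD /= b0.
exists (fun t : gidx => if t.1.1 then if (0 < t.1.2)%N then w t.1.2 t.2 else 0 else u t).
  move=> [[[] a] U] /=; rewrite /gvalid /=.
    case: ifP => //= a0 v; have [sw _] := wP a a0.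
    by apply: sw; rewrite andbC.
  exact: uval.
move=> [[[] a] U]; last by rewrite /gD /= ue.
have [a0|a0] := boolP (0 < a)%N; last first.
  by rewrite sf /gD /= ?(negbTE a0) // /gvalid /= (negbTE a0) andbF.
have [_ wE] := wP a a0; rewrite /gD /= a0 -wE /ph opprB addrC subrK //.
Qed.

Lemma gexactS i f : gsupp i.+2 f -> gD X f =1 (fun=> 0) ->
  exists2 g, gsupp i.+3 g & f =1 gD X g.
Proof.
move=> sf df.
have /choice[u uP] a : exists u : {set 'I_n} -> S, ksupp (~: F a) i.+2 u /\
    (forall U, f (false, a, U) = kd X u U).
  have [||u ? ?] := @koszul_exact K n (~: F a) i (fun U => f (false, a, U));
    last by exists u.
  - by move=> U UN; apply: sf; rewrite /gvalid /= eqSS andbC.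
  - by move=> U; have := df (false, a, U).
apply: (@gexact_aux _ _ (fun t : gidx => if t.1.1 then 0 else u t.1.2 t.2)) => //.
  move=> [[[] a] U] //=; rewrite /gvalid /= eqSS andbC => v.
  by have [su _] := uP a; apply: su.
by move=> a U; have [_ <-] := uP a.
Qed.

(** Degree 1 carries the homology K[D]; the last hypothesis makes the class of f vanish on every
    facet. *)
Lemma gexact1 f : gsupp 1 f -> gD X f =1 (fun=> 0) ->
  (forall a, van (powerset (F a)) (f (false, a, set0))) ->
  exists2 g, gsupp 2 g & f =1 gD X g.
Proof.
move=> sf df vf.
have /choice[u uP] a : exists u : {set 'I_n} -> S, ksupp (~: F a) 1 u /\
    (forall U, f (false, a, U) = kd X u U).
  have [||u ? ?] := @koszul_exact0 K n (F a) (fun U => f (false, a, U));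
    last by exists u.
  - by move=> U UN; apply: sf; rewrite /gvalid /= eqSS andbC.
  - exact: vf.
apply: (@gexact_aux _ _ (fun t : gidx => if t.1.1 then 0 else u t.1.2 t.2)) => //.
  move=> [[[] a] U] //=; rewrite /gvalid /= eqSS andbC => v.
  by have [su _] := uP a; apply: su.
by move=> a U; have [_ <-] := uP a.
Qed.

Lemma gexact0 f : gsupp 0 f -> exists2 g : gidx -> S, gsupp 1 g & f =1 gD X g.
Proof.
move=> sf; have [u uP] := tree_primitive (fun b => f (true, b, set0)).
exists (fun t : gidx => if t.1.1 then 0 else if t.2 == set0 then u t.1.2 else 0).
  move=> [[[] a] U] //=; rewrite /gvalid /= eqSS cards_eq0.
  by case: eqP => //= ->; rewrite sub0set.
move=> [[[] a] U]; rewrite /gD /=; last first.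
  rewrite sf /gvalid //= /kd big1 // => i iU; case: eqP; rewrite ?mulr0 //.
  by move=> /setP/(_ i); rewrite setU11 inE.
case: ifP => a0; last by rewrite sf // /gvalid /= a0 andbF.
rewrite kd0 subr0; case: eqP => [->|/eqP U0]; first by rewrite uP.
by rewrite subr0 sf // /gvalid /= cards_eq0 (negbTE U0).
Qed.

(* A kernel element is constant along the tree of facets for each U, and vanishes
   on any facet meeting U. *)
Lemma gD_nodes_inj (cov : forall v, exists a, v \in F a) i (f : gidx -> K) :
  gsupp i.+2 f -> gD (fun=> 0) f =1 (fun=> 0) ->
  forall a U, f (false, a, U) = 0.
Proof.
move=> sf df.
have fval a (U : {set 'I_n}) : ~~ (U \subset ~: F a) -> f (false, a, U) = 0.
  by move=> h; apply: sf; rewrite /gvalid /= (negbTE h) andbF.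
have eqP' (b : 'I_k) U : (0 < b)%N -> f (false, b, U) = f (false, P b, U).
  move=> b0; have := df (true, b, U); rewrite /gD /= b0.
  rewrite /kd big1 => [/eqP|j _]; last by rewrite mulr0 mul0r.
  by rewrite subr0 subr_eq0 => /eqP.
move=> a U; have [U0|[v vU]] := set_0Vmem U.
  by apply: sf; rewrite /gvalid /= U0 cards0.
have k0 : (0 < k)%N by apply: leq_ltn_trans (ltn_ord a).
have eq0 : forall b, f (false, b, U) = f (false, Ordinal k0, U).
  apply: tree_ind => b IH; have [b0|b0] := posnP b.
    by congr (f (_, _, _)); apply: val_inj.
  by rewrite eqP' // IH // Plt.
have [c vc] := cov v; rewrite eq0 -(eq0 c) fval //.
by apply/subsetPn; exists v; rewrite // inE vc.
Qed.

End OverField.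
End GluingComplex.

(** * Exact complexes of free modules under base change *)

Section Splitting.

Lemma rows_lift (R : pzRingType) m p q (M : 'M[R]_(m, p)) (E : 'M[R]_(q, p)) :
  (forall l, exists v : 'rV_q, row l M = v *m E) -> exists V, M = V *m E.
Proof.
move=> /choice[v vE]; exists (\matrix_l v l).
by apply/row_matrixP => l; rewrite row_mul rowK.
Qed.

(* The complex splits: inductively there are s_i with E_i s_i E_i = E_i. *)
Lemma exact_map_mx (R A : pzRingType) (h : {rmorphism R -> A}) (N : nat -> nat)
    (E : forall i, 'M[R]_(N i.+1, N i)) :
  (forall u : 'rV_(N 0), exists v, u = v *m E 0) ->
  (forall i, E i.+1 *m E i = 0) ->
  (forall i (u : 'rV_(N i.+1)), u *m E i = 0 -> exists v, u = v *m E i.+1) ->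
  forall i (u : 'rV_(N i.+1)), u *m map_mx h (E i) = 0 ->
    exists v, u = v *m map_mx h (E i.+1).
Proof.
move=> ex0 EE exS.
have step i s : E i *m s *m E i = E i -> exists s', 1%:M = E i *m s + s' *m E i.+1.
  move=> EsE; have [] := @rows_lift R _ _ _ (1%:M - E i *m s) (E i.+1).
    move=> l; apply: exS; rewrite -row_mul mulmxBl mul1mx EsE subrr.
    by apply/rowP => j; rewrite !mxE.
  by move=> s' e; exists s'; rewrite -e addrC subrK.
have splits i : exists s, E i *m s *m E i = E i.
  elim: i => [|i [s /step[s' e]]].
    have [|s e] := @rows_lift R _ _ _ 1%:M (E 0); first by move=> l; apply: ex0.
    by exists s; rewrite -mulmxA -e mulmx1.
  exists s'; have := congr1 (mulmx (E i.+1)) e.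
  by rewrite mulmx1 mulmxDr mulmxA EE mul0mx add0r mulmxA => <-.
move=> i u uE; have [s /step[s' e]] := splits i.
exists (u *m map_mx h s'); have := congr1 (map_mx h) e.
rewrite map_mx1 map_mxD !map_mxM => /(congr1 (mulmx u)).
by rewrite mulmx1 mulmxDr mulmxA uE mul0mx add0r mulmxA.
Qed.

(** Serves to build a chain map degree by degree: the types vary with the degree, and [Q] records
    that the part chosen so far can be extended. *)
Lemma dependent_choice_seq (T : nat -> Type) (Q : forall i, T i -> Prop)
    (R : forall i, T i -> T i.+1 -> Prop) (x0 : T 0) :
  Q 0 x0 -> (forall i x, Q i x -> exists y, Q i.+1 y /\ R i x y) ->
  exists f : forall i, T i, f 0 = x0 /\ forall i, Q i (f i) /\ R i (f i) (f i.+1).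
Proof.
move=> Q0 step.
have nxt i (x : {x | Q i x}) : {y : {y | Q i.+1 y} | R i (sval x) (sval y)}.
  case: x => x Qx /=; have [y [Qy Ry]] := cid (step i x Qx).
  by exists (exist _ y Qy).
pose g := fix g i : {x | Q i x} :=
  match i with 0 => exist _ x0 Q0 | i'.+1 => sval (nxt i' (g i')) end.
exists (fun i => sval (g i)); split=> // i; split; first exact: svalP.
exact: (svalP (nxt i (g i))).
Qed.

End Splitting.

(** * Homogeneous components of polynomials *)

Section HomogComp.
Variables (K : fieldType) (n : nat).
Local Notation S := {mpoly K[n]}.
Implicit Types (p q : S) (z e : int).

Definition hcomp z p : S := mfilter (fun m => (mdeg m)%:Z == z) p.

Lemma mcoeff_hcomp z p m : (hcomp z p)@_m = if (mdeg m)%:Z == z then p@_m else 0.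
Proof. exact: mcoeff_mfilter. Qed.

Lemma homog_ofP z p : homog_of z p <-> forall m, (mdeg m)%:Z != z -> p@_m = 0.
Proof.
split=> [h m|h m]; last first.
  by rewrite mcoeff_msupp => pm; apply/eqP; apply: contraNT pm => /h ->.
by move=> mz; apply: memN_msupp_eq0; apply: contraNN mz => /h ->.
Qed.

Lemma hcomp_homog z p : homog_of z (hcomp z p).
Proof. by apply/homog_ofP => m mz; rewrite mcoeff_hcomp (negbTE mz). Qed.

Lemma hcomp_id z p : homog_of z p -> hcomp z p = p.
Proof.
move=> /homog_ofP h; apply/mpolyP => m; rewrite mcoeff_hcomp.
by case: ifPn => // /h.
Qed.

Lemma hcompD z p q : hcomp z (p + q) = hcomp z p + hcomp z q.
Proof.
apply/mpolyP => m; rewrite mcoeffD !mcoeff_hcomp mcoeffD.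
by case: ifP => // _; rewrite addr0.
Qed.

Lemma hcomp0 z : hcomp z 0 = 0.
Proof. by apply/mpolyP => m; rewrite mcoeff_hcomp mcoeff0 if_same. Qed.

Lemma hcomp_sum z (I : Type) (r : seq I) (P : pred I) (f : I -> S) :
  hcomp z (\sum_(i <- r | P i) f i) = \sum_(i <- r | P i) hcomp z (f i).
Proof. exact: (big_morph (hcomp z) (hcompD z) (hcomp0 z)). Qed.

Lemma hcompM z e p q : homog_of e q -> hcomp z (p * q) = hcomp (z - e) p * q.
Proof.
move=> /homog_ofP hq; apply/mpolyP => m; rewrite mcoeff_hcomp.
have aux (a b : 'X_{1..n}) : m = (a + b)%MM ->
    (hcomp (z - e) p)@_a * q@_b = if (mdeg m)%:Z == z then p@_a * q@_b else 0.
  move=> ab; have [be|/hq ->] := eqVneq ((mdeg b)%:Z) e; last first.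
    by rewrite !mulr0 if_same.
  rewrite mcoeff_hcomp ab mdegD PoszD be -[in RHS](inj_eq (addIr (- e))) addrK.
  by case: ifP; rewrite ?mul0r.
rewrite !mcoeffM (eq_bigr _ (fun k h => aux _ _ (eqP h))).
by case: ifP => // _; rewrite big1.
Qed.

Lemma homog_ofD z p q : homog_of z p -> homog_of z q -> homog_of z (p + q).
Proof. by move=> hp hq; rewrite -(hcomp_id hp) -(hcomp_id hq) -hcompD; apply: hcomp_homog. Qed.

Lemma homog_ofN z p : homog_of z p -> homog_of z (- p).
Proof. by move=> /homog_ofP h; apply/homog_ofP => m /h e; rewrite mcoeffN e oppr0. Qed.

Lemma homog_of0 z : homog_of z (0 : S).
Proof. by apply/homog_ofP => m; rewrite mcoeff0. Qed.

Lemma homog_of_sum z (I : Type) (r : seq I) (P : pred I) (f : I -> S) :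
  (forall i, P i -> homog_of z (f i)) -> homog_of z (\sum_(i <- r | P i) f i).
Proof.
by move=> h; elim/big_ind: _ => //; [apply: homog_of0|apply: homog_ofD].
Qed.

Lemma homog_ofM z e p q : homog_of z p -> homog_of e q -> homog_of (z + e) (p * q).
Proof.
move=> hp hq; rewrite -(hcomp_id hp) -[z in hcomp z](addrK e) -(hcompM _ _ hq).
exact: hcomp_homog.
Qed.

Lemma homog_ofC (c : K) : homog_of 0 (c%:MP : S).
Proof.
apply/homog_ofP => m; rewrite mcoeffC; case: (eqVneq m 0%MM) => [->|]; last by rewrite mulr0.
by rewrite mdeg0 eqxx.
Qed.

Lemma homog_ofX i : homog_of 1 ('X_i : S).
Proof.
apply/homog_ofP => m; rewrite mcoeffX; case: (eqVneq U_(i)%MM m) => // <-.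
by rewrite mdeg1 eqxx.
Qed.

Lemma homog_of_mcoeff0 z p : homog_of z p -> p@_0%MM != 0 -> z = 0.
Proof. by rewrite -mcoeff_msupp => h /h <-; rewrite mdeg0. Qed.

(** A homogeneous entry merely shifts components, so any lift can be cut down to its components of
    the right degrees. The comparison map has to respect degrees for Tor to be compared degree by
    degree. *)
Lemma homog_lift (m w : nat) (delta : int) (e : 'I_m -> int) (e' : 'I_w -> int)
    (E : 'M[S]_(m, w)) (y : 'rV[S]_m) (c : 'rV[S]_w) :
  (forall l j, homog_of (e l - e' j) (E l j)) ->
  (forall j, homog_of (delta - e' j) (c 0 j)) -> c = y *m E ->
  c = (\row_l hcomp (delta - e l) (y 0 l)) *m E.
Proof.
move=> hE hc ec; apply/rowP => j; rewrite -(hcomp_id (hc j)) ec !mxE hcomp_sum.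
apply: eq_bigr => l _; rewrite (hcompM _ _ (hE l j)) mxE; congr (hcomp _ _ * _).
by rewrite opprB addrA subrK.
Qed.

End HomogComp.

(** * The gluing complex in matrix form *)

Section GluingMatrices.
Variables (n k : nat) (F G : 'I_k -> {set 'I_n}) (P : 'I_k -> 'I_k).
Hypothesis Plt : forall b : 'I_k, (0 < b)%N -> (P b < b)%N.
Hypothesis GF : forall b : 'I_k, (0 < b)%N -> G b \subset F b.
Hypothesis GP : forall b : 'I_k, (0 < b)%N -> G b \subset F (P b).
Hypothesis capG : forall a b : 'I_k, (a < b)%N -> F a :&: F b \subset G b.

Local Notation N i := #|gvalid F G i|.
Local Notation gidx := (gidx n k).

Section AnyRing.
Variables (A : comNzRingType) (x : 'I_n -> A).

Definition grow i (f : gidx -> A) : 'rV[A]_(N i) := \row_p f (enum_val p).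

Definition gfun i (y : 'rV[A]_(N i)) : gidx -> A :=
  fun t => \sum_p y 0 p * (t == enum_val p)%:R.

Definition gmx i : 'M[A]_(N i.+1, N i) :=
  \matrix_(p, q) gD P x (fun s => (s == enum_val p)%:R) (enum_val q).

Lemma gfunK i : cancel (@gfun i) (@grow i).
Proof.
move=> y; apply/rowP => p; rewrite mxE /gfun (bigD1 p) //= eqxx mulr1 big1.
  by rewrite addr0.
by move=> q qp; rewrite (inj_eq enum_val_inj) eq_sym (negbTE qp) mulr0.
Qed.

Lemma gfun_supp i y : gsupp F G i (@gfun i y).
Proof.
move=> t tv; rewrite /gfun big1 // => p _; case: eqP => [e|_]; last by rewrite mulr0.
by have := enum_valP p; rewrite -e => tv'; case/negP: tv.
Qed.

Lemma growK i f : gsupp F G i f -> gfun (grow i f) =1 f.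
Proof.
move=> sf t; have [tv|tv] := boolP (gvalid F G i t); last by rewrite gfun_supp ?sf.
have te : t = enum_val (enum_rank_in (A := gvalid F G i) tv t) by rewrite enum_rankK_in.
rewrite /gfun (bigD1 (enum_rank_in (A := gvalid F G i) tv t)) //= -te eqxx mulr1.
rewrite mxE -te big1 ?addr0 // => p pe; case: eqP => [e|]; last by rewrite mulr0.
by case/eqP: pe; apply: enum_val_inj; rewrite -te.
Qed.

Lemma grow_mul i f : gsupp F G i.+1 f -> grow i.+1 f *m gmx i = grow i (gD P x f).
Proof.
move=> sf; apply/rowP => q; rewrite !mxE -(eq_gD P x (growK sf)) /gfun gD_sum.
by apply: eq_bigr => p _; rewrite !mxE gDZ.
Qed.

Lemma gfun_mul i (y : 'rV_(N i.+1)) : gfun (y *m gmx i) =1 gD P x (gfun y).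
Proof.
move=> t; rewrite -{1}(gfunK y) grow_mul; last exact: gfun_supp.
by apply: growK; apply: gD_supp => //; apply: gfun_supp.
Qed.

Lemma gfun_eq0 i (y : 'rV[A]_(N i)) : gfun y =1 (fun=> 0) -> y = 0.
Proof.
by move=> h; rewrite -(gfunK y); apply/rowP => p; rewrite !mxE h.
Qed.

Lemma gfun0 i t : gfun (0 : 'rV[A]_(N i)) t = 0.
Proof. by rewrite /gfun big1 // => p _; rewrite mxE mul0r. Qed.

Lemma gmx_gmx i : gmx i.+1 *m gmx i = 0.
Proof.
apply/row_matrixP => p; rewrite row_mul row0; apply: gfun_eq0 => t.
rewrite gfun_mul rowE; set y := delta_mx _ _.
rewrite (eq_gD P x (gfun_mul y)); exact: gD_gD.
Qed.

Lemma gmx_lift i (y : 'rV[A]_(N i)) g :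
  gsupp F G i.+1 g -> gfun y =1 gD P x g -> exists v, y = v *m gmx i.
Proof.
move=> sg e; exists (grow i.+1 g); rewrite grow_mul // -(gfunK y).
by apply/rowP => p; rewrite !mxE e.
Qed.

End AnyRing.

Section OverField.
Variable K : fieldType.
Local Notation S := {mpoly K[n]}.
Local Notation X := (fun i : 'I_n => 'X_i : S).

Lemma map_gmx i : map_mx (mcoeff 0%MM) (gmx X i) = gmx (fun=> 0 : K) i.
Proof.
apply/matrixP => p q; rewrite !mxE gD_mcoeff0; apply: eq_gD => s.
by case: eqP => _; rewrite ?mcoeff1 ?eqxx ?mcoeff0.
Qed.

(** The internal degree depends on U alone, while the homological degree differs by one between
    nodes and edges. *)
Definition gdeg (t : gidx) : int := #|t.2|.

Lemma gmx_homog i p q :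
  homog_of (gdeg (enum_val p) - gdeg (enum_val q)) (gmx X i p q).
Proof.
rewrite mxE; have kdh b a (V : {set 'I_n}) t : homog_of (gdeg t - #|V|%:Z)
    (kd X (fun W => ((b, a, W) == t :> gidx)%:R) V).
  apply: homog_of_sum => j jV; case: eqP => [e|]; last first.
    by rewrite mulr0 => _; apply: homog_of0.
  rewrite mulr1 -e /gdeg /= cardsU1 jV add1n -addn1 PoszD addrAC subrr.
  apply: homog_ofM; last exact: homog_ofX.
  rewrite /ksg -signr_odd; case: odd; rewrite ?expr0 ?expr1.
    by rewrite -mpolyC1 -mpolyCN; apply: homog_ofC.
  by rewrite -mpolyC1; apply: homog_ofC.
have ind b a (V : {set 'I_n}) t : homog_of (gdeg t - #|V|%:Z) (((b, a, V) == t :> gidx)%:R : S).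
  case: eqP => [<-|_]; last exact: homog_of0.
  by rewrite subrr -mpolyC1; apply: homog_ofC.
rewrite /gD; case: ifP => _; last exact: kdh.
case: ifP => _; last exact: homog_of0.
by rewrite -addrA -opprD; apply: homog_ofD; [|apply: homog_ofN; apply: homog_ofD];
  [exact: ind|exact: ind|exact: kdh].
Qed.

Lemma gmx_exact0 (y : 'rV[S]_(N 0)) : exists v, y = v *m gmx X 0.
Proof.
have [g sg e] := gexact0 Plt (@gfun_supp _ _ y).
exact: gmx_lift sg e.
Qed.

Lemma gmx_cycle (A : comNzRingType) (x : 'I_n -> A) i (y : 'rV[A]_(N i.+1)) :
  y *m gmx x i = 0 -> gD P x (gfun y) =1 (fun=> 0).
Proof. by move=> e t; rewrite -gfun_mul e gfun0. Qed.

Lemma gmx_exact1 (y : 'rV[S]_(N 1)) : y *m gmx X 0 = 0 ->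
  (forall a, van (powerset (F a)) (gfun y (false, a, set0))) ->
  exists v, y = v *m gmx X 1.
Proof.
move=> /gmx_cycle e h; have [g sg eg] := gexact1 GF GP (@gfun_supp _ _ y) e h.
exact: gmx_lift sg eg.
Qed.

Lemma gmx_exactS i (y : 'rV[S]_(N i.+2)) : y *m gmx X i.+1 = 0 ->
  exists v, y = v *m gmx X i.+2.
Proof.
move=> /gmx_cycle e; have [g sg eg] := gexactS GF GP (@gfun_supp _ _ y) e.
exact: gmx_lift sg eg.
Qed.

End OverField.
End GluingMatrices.

(** * Comparison with a free resolution *)

Section Cone.
Variables (n k : nat) (F G : 'I_k -> {set 'I_n}) (P : 'I_k -> 'I_k).
Hypothesis Plt : forall b : 'I_k, (0 < b)%N -> (P b < b)%N.
Hypothesis GF : forall b : 'I_k, (0 < b)%N -> G b \subset F b.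
Hypothesis GP : forall b : 'I_k, (0 < b)%N -> G b \subset F (P b).
Hypothesis capG : forall a b : 'I_k, (a < b)%N -> F a :&: F b \subset G b.
Variables (K : fieldType) (D : scomplex n).
Hypothesis DF : forall s : {set 'I_n}, s \in faces D <-> exists a, s \subset F a.
Variable Fr : free_resolution K D.

Local Notation S := {mpoly K[n]}.
Local Notation X := (fun i : 'I_n => 'X_i : S).
Local Notation N i := #|gvalid F G i|.
Local Notation rk := (fr_rank Fr).
Local Notation gX := (gmx F G P X).

Lemma van_facets (p : S) : van (faces D) p <-> forall a, van (powerset (F a)) p.
Proof.
split=> [h a m|h m /DF[a ma]]; last by apply: (h a); rewrite powersetE.
by rewrite powersetE => ma; apply: h; apply/DF; exists a.
Qed.

Lemma fr_diff_diff i : fr_diff Fr i.+1 *m fr_diff Fr i = 0.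
Proof.
apply/row_matrixP => l; rewrite row_mul row0; apply/(fr_exactS _).
by exists (delta_mx 0 l); rewrite rowE.
Qed.

(** A lift to S of the diagonal image of p in the sum of the K[F_a]. *)
Definition const_section (p : S) (t : gidx n k) : S :=
  if ~~ t.1.1 && (t.2 == set0) then p else 0.

Lemma const_section_supp p : gsupp F G 1 (const_section p).
Proof.
move=> [[[] a] U] //=; rewrite /gvalid /const_section /= eqSS cards_eq0.
by case: eqP => //= ->; rewrite sub0set.
Qed.

Lemma gD_const_section p : gD P X (const_section p) =1 (fun=> 0).
Proof.
move=> [[[] a] U]; rewrite /gD /const_section /=; last first.
  rewrite /kd big1 // => i iU; case: eqP; rewrite ?mulr0 //.
  by move=> /setP/(_ i); rewrite setU11 inE.
by case: ifP => // _; rewrite kd0 subrr subr0.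
Qed.

Lemma gfun_sum i (I : finType) (c : I -> S) (y : I -> 'rV[S]_(N i)) t :
  gfun (\sum_j c j *: y j) t = \sum_j c j * gfun (y j) t.
Proof.
rewrite /gfun; under [RHS]eq_bigr => j _ do rewrite mulr_sumr.
rewrite exchange_big; apply: eq_bigr => q _ /=; rewrite summxE mulr_suml.
by apply: eq_bigr => j _; rewrite mxE mulrA.
Qed.

(** The gluing complex resolves K[D] from degree 1 on, so the augmentation lifts to a chain map that
    sends degree i of [Fr] to degree i + 1. *)
Lemma comparison_map : exists (p : 'I_(rk 0) -> S)
    (al : forall i, 'M[S]_(rk i, N i.+1)),
  [/\ forall l, fr_aug l = SR_pi D (p l),
      al 0 = \matrix_l grow F G 1 (const_section (p l)),
      forall i, al i.+1 *m gX i.+1 = fr_diff Fr i *m al i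
    & forall i l q, homog_of (fr_deg l - gdeg (enum_val q)) (al i l q)].
Proof.
have /choice[p pP] (l : 'I_(rk 0)) : exists p : S, homog_of (fr_deg l) p /\ fr_aug l = SR_pi D p.
  by have [p hp ep] := fr_aug_homog l; exists p.
pose hom i (al : 'M[S]_(rk i, N i.+1)) :=
  forall l q, homog_of (fr_deg l - gdeg (enum_val q)) (al l q).
pose Q i al := hom i al /\
  forall l, exists v, row l (fr_diff Fr i *m al) = v *m gX i.+1.
pose R i al be := be *m gX i.+1 = fr_diff Fr i *m al.
pose al0 : 'M[S]_(rk 0, N 1) := \matrix_l grow F G 1 (const_section (p l)).
have [||al [al0E alP]] := @dependent_choice_seq _ Q R al0; last first.
- exists p, al; split=> // [l|i|i].
  + by have [] := pP l.
  + by have [_] := alP i.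
  + by have [[]] := alP i.
- move=> i al [hal /choice[v vE]].
  pose be : 'M[S]_(rk i.+1, N i.+2) :=
    \matrix_(l, q) hcomp (fr_deg l - gdeg (enum_val q)) (v l 0 q).
  have beE : be *m gX i.+1 = fr_diff Fr i *m al.
    apply/row_matrixP => l; rewrite row_mul.
    rewrite (@homog_lift K n _ _ (fr_deg l) (fun q => gdeg (enum_val q))
      (fun q => gdeg (enum_val q)) _ _ _ _ _ (vE l)).
    + by congr (_ *m _); apply/rowP => q; rewrite !mxE.
    + by move=> q q'; apply: gmx_homog.
    + move=> q; rewrite !mxE; apply: homog_of_sum => l' _.
      rewrite -(subrK (fr_deg l') (fr_deg l)) -addrA.
      by apply: homog_ofM; [apply: fr_diff_homog|apply: hal].
  exists be; split=> //; split.
    by move=> l q; rewrite mxE; apply: hcomp_homog.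
  move=> l; apply: gmx_exactS => //.
  rewrite -row_mul -mulmxA beE mulmxA fr_diff_diff mul0mx.
  by apply/rowP => q; rewrite !mxE.
split.
  move=> l q; rewrite !mxE /const_section; case: ifP => [/andP[_ /eqP U0]|_].
    by rewrite /gdeg U0 cards0 subr0; have [] := pP l.
  exact: homog_of0.
move=> l; have rowE' : row l (fr_diff Fr 0 *m al0) =
    \sum_j fr_diff Fr 0 l j *: grow F G 1 (const_section (p j)).
  rewrite row_mul mulmx_sum_row; apply: eq_bigr => j _.
  by rewrite mxE rowK.
(* A row of the first differential is a relation among the values of the augmentation, so the
   constant section that it yields vanishes on every facet. *)
apply: gmx_exact1 => //.
  rewrite rowE' mulmx_suml big1 // => j _.
  rewrite -scalemxAl grow_mul //; last exact: const_section_supp.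
  by apply/rowP => q; rewrite !mxE gD_const_section mulr0.
move=> a; rewrite rowE' gfun_sum.
under eq_bigr => j _ do rewrite (growK (const_section_supp _)) /const_section /= eqxx.
move: a; apply/van_facets/SR_pi_eq0; rewrite rmorph_sum.
have [_] := fr_exact0 (row l (fr_diff Fr 0)).
move=> /(_ (ex_intro _ (delta_mx 0 l) (rowE _ _))) e; rewrite -[RHS]e.
by apply: eq_bigr => j _; rewrite rmorphM mxE; have [_ ->] := pP j.
Qed.

(** Degree i of [Fr] maps to degree i + 1 of the gluing complex and the cone raises it by one more;
    hence the shift by two. *)
Definition crank i := match i with i'.+2 => rk i' | _ => 0%N end.

Definition cdiff i : 'M[S]_(crank i.+1, crank i) :=
  match i with i'.+2 => fr_diff Fr i' | _ => 0 end.

Section WithMap.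
Variables (p : 'I_(rk 0) -> S) (al : forall i, 'M[S]_(rk i, N i.+1)).
Hypothesis augE : forall l, fr_aug l = SR_pi D (p l).
Hypothesis al0E : al 0 = \matrix_l grow F G 1 (const_section (p l)).
Hypothesis alE : forall i, al i.+1 *m gX i.+1 = fr_diff Fr i *m al i.

Definition calpha i : 'M[S]_(crank i.+1, N i) :=
  match i with i'.+1 => al i' | _ => 0 end.

Definition cone i : 'M[S]_(N i.+1 + crank i.+1, N i + crank i) :=
  block_mx (gX i) 0 (calpha i) (- cdiff i).

Lemma calphaE i : calpha i.+1 *m gX i = cdiff i.+1 *m calpha i.
Proof.
case: i => [|i] /=; last exact: alE.
rewrite mul0mx al0E; apply/row_matrixP => l; rewrite row_mul rowK row0.
rewrite grow_mul //; last exact: const_section_supp.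
by apply/rowP => q; rewrite !mxE gD_const_section.
Qed.

Lemma cone_cone i : cone i.+1 *m cone i = 0.
Proof.
rewrite /cone mulmx_block gmx_gmx // !mul0mx !mulmx0 !addr0 calphaE.
have dd : cdiff i.+1 *m cdiff i = 0.
  by case: i => [|[|i]] /=; rewrite ?mulmx0 // fr_diff_diff.
by rewrite !mulNmx subrr mulmxN opprK dd addr0 block_mx0.
Qed.

Lemma cone_exact0 (u : 'rV_(N 0 + crank 0)) : exists v, u = v *m cone 0.
Proof.
have [v e] := gmx_exact0 Plt (lsubmx u).
exists (row_mx v 0); rewrite /cone mul_row_block mul0mx !addr0 -e mulmx0.
rewrite -[LHS]hsubmxK; congr row_mx.
exact: (etrans (thinmx0 _) (esym (thinmx0 _))).
Qed.

Lemma sub_al0 (f : 'rV_(rk 0)) a :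
  gfun (f *m al 0) (false, a, set0) = \sum_l f 0 l * p l.
Proof.
rewrite al0E mulmx_sum_row gfun_sum; apply: eq_bigr => l _.
by rewrite rowK (growK (const_section_supp _)) /const_section /= eqxx.
Qed.

(** In a cycle (y, f) above degree 1, f is a boundary, and correcting y accordingly gives a cycle of
    the gluing complex, which is exact there. In degree 1 there is no f, and the homology K[D] is
    killed by the surjectivity of the augmentation. *)
Lemma cone_exactS i (u : 'rV_(N i.+1 + crank i.+1)) : u *m cone i = 0 ->
  exists v, u = v *m cone i.+1.
Proof.
rewrite -[u]hsubmxK; move: (lsubmx u) (rsubmx u) => y f {u}.
rewrite /cone mul_row_block mulmx0 add0r mulmxN -row_mx0 => /eq_row_mx[].
case: i y f => [|i] y f yf fd.
  rewrite /= mulmx0 addr0 in yf.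
  pose u0 a := gfun y (false, a, set0).
  (* The node values agree modulo the ideals of the G_b, hence glue to one s. Once the class of s is
     lifted to c through the augmentation, y minus the image of c vanishes on all facets. *)
  have [b b0|s sP] := @glue_sections n k F G P Plt GP capG K u0.
    have := gmx_cycle GF GP yf (true, b, set0); rewrite /gD /= b0 => /eqP.
    rewrite subr_eq0 -/(u0 b) -/(u0 (P b)) => /eqP ->.
    apply: van_kd => U UN; apply: gfun_supp; rewrite /gvalid /= b0 /=.
    by rewrite andbC.
  have [c cE] := @fr_aug_surj _ _ _ Fr (SR_pi D s).
  have [] := @gmx_exact1 _ _ F G P GF GP K (y - c *m al 0).
  - have := calphaE 0; rewrite /= mul0mx => e.
    by rewrite mulmxBl yf -mulmxA e mulmx0 subrr.
  - move=> a; have -> : gfun (y - c *m al 0) (false, a, set0) =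
        (s - \sum_l c 0 l * p l) - (s - u0 a).
      rewrite opprB [RHS]addrC addrA subrK -(sub_al0 c a) /gfun -sumrB.
      by apply: eq_bigr => q _; rewrite !mxE mulrBl.
    apply: vanB; last exact: sP.
    move: a; apply/van_facets/SR_pi_eq0; rewrite rmorphB rmorph_sum /= cE.
    apply/eqP; rewrite subr_eq0; apply/eqP; apply: eq_bigr => l _.
    by rewrite rmorphM augE.
  move=> v e; exists (row_mx v c); rewrite mul_row_block mulmx0 add0r.
  by rewrite -e subrK; congr row_mx; rewrite [f]thinmx0 [RHS]thinmx0.
have [v fE] : exists v, f = v *m cdiff i.+2.
  case: i y f yf fd => [|i] y f yf fd; last first.
    apply/fr_exactS; apply: oppr_inj; by rewrite oppr0.
  (* On the nodes the image of f is minus a Koszul boundary, so the augmentation of f vanishes on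
     every facet. *)
  apply/fr_exact0; under eq_bigr => l _ do rewrite augE -rmorphM.
  rewrite -rmorph_sum; apply/SR_pi_eq0/van_facets => a; rewrite -(sub_al0 f a).
  have /(congr1 (fun z => gfun z (false, a, set0))) := yf.
  have -> : gfun (y *m gX 1 + f *m al 0) (false, a, set0) =
     gfun (y *m gX 1) (false, a, set0) + gfun (f *m al 0) (false, a, set0).
    by rewrite /gfun -big_split; apply: eq_bigr => q _; rewrite mxE mulrDl.
  rewrite gfun0 addrC gfun_mul // => /eqP; rewrite addr_eq0 => /eqP ->.
  apply: vanN; apply: van_kd => U UN; apply: gfun_supp.
  by rewrite /gvalid /= eqSS andbC.
have [] := @gmx_exactS _ _ F G P GF GP K i (y + v *m calpha i.+2).
  by rewrite mulmxDl -[v *m _ *m _]mulmxA calphaE mulmxA -fE.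
move=> z e; exists (row_mx z (- v)); rewrite mul_row_block mulmx0 add0r.
by rewrite -e mulNmx addrK mulmxN mulNmx opprK -fE.
Qed.

Lemma cone_exact_field i (u : 'rV_(N i.+1 + crank i.+1)) :
  u *m map_mx (mcoeff 0%MM) (cone i) = 0 ->
  exists v, u = v *m map_mx (mcoeff 0%MM) (cone i.+1).
Proof.
apply: (@exact_map_mx S K (mcoeff 0%MM) (fun i => N i + crank i)%N cone).
- exact: cone_exact0.
- exact: cone_cone.
- exact: cone_exactS.
Qed.

End WithMap.

(* The exactness of the cone over K, spelled out in each degree. *)
Lemma comparison_over_field i : exists A : 'M[K]_(rk i.+1, N i.+2),
  [/\ forall l q, A l q != 0 -> fr_deg l = gdeg (enum_val q),
      forall u : 'rV_(rk i.+1), u *m tor_diff Fr i = 0 ->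
        u *m A *m gmx F G P (fun=> 0) i.+1 = 0,
      forall (u : 'rV_(rk i.+1)) x, u *m tor_diff Fr i = 0 ->
        u *m A = x *m gmx F G P (fun=> 0) i.+2 ->
        exists v, u = v *m tor_diff Fr i.+1,
      forall v, exists x,
        v *m tor_diff Fr i.+1 *m A = x *m gmx F G P (fun=> 0) i.+2 :> 'rV_(N i.+2)
    & forall z : 'rV_(N i.+2), z *m gmx F G P (fun=> 0) i.+1 = 0 ->
        exists x, exists v, z = x *m gmx F G P (fun=> 0) i.+2 + v *m A
          /\ v *m tor_diff Fr i = 0].
Proof.
have [p [al [augE al0E alE alh]]] := comparison_map.
have ex := cone_exact_field augE al0E alE.
have coneE j : map_mx (mcoeff 0%MM) (cone al j.+2) =
  block_mx (gmx F G P (fun=> 0) j.+2) 0 (map_mx (mcoeff 0%MM) (al j.+1))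
    (- tor_diff Fr j).
  by rewrite /cone map_block_mx map_gmx map_mx0 map_mxN.
exists (map_mx (mcoeff 0%MM) (al i.+1)); split.
- move=> l q; rewrite mxE => /(homog_of_mcoeff0 (alh _ _ _))/eqP.
  by rewrite subr_eq0 => /eqP.
- move=> u ud; rewrite -map_gmx -mulmxA -map_mxM alE map_mxM mulmxA.
  by rewrite -/(tor_diff Fr i) ud mul0mx.
- move=> u x ud uA; have [|v] := ex i.+2 (row_mx (- x) u).
    by rewrite coneE mul_row_block mulNmx uA addNr mulmx0 add0r mulmxN ud oppr0 row_mx0.
  rewrite coneE -[v]hsubmxK mul_row_block => /eq_row_mx[_].
  by rewrite mulmx0 add0r mulmxN -mulNmx => ->; exists (- rsubmx v).
- move=> v; exists (v *m map_mx (mcoeff 0%MM) (al i.+2)).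
  by rewrite -map_gmx -!mulmxA /tor_diff -!map_mxM alE.
- move=> z zd; have e1 : map_mx (mcoeff 0%MM) (cone al i.+1) =
    block_mx (gmx F G P (fun=> 0) i.+1) 0 (map_mx (mcoeff 0%MM) (al i))
      (- map_mx (mcoeff 0%MM) (cdiff i.+1)).
    by rewrite /cone map_block_mx map_gmx map_mx0 map_mxN.
  have [|v] := ex i.+1 (row_mx z 0).
    by rewrite e1 mul_row_block zd !mul0mx mulmx0 !addr0 row_mx0.
  rewrite coneE -[v]hsubmxK mul_row_block => /eq_row_mx[-> e].
  exists (lsubmx v), (rsubmx v); split=> //.
  by apply: oppr_inj; rewrite oppr0 e mulmx0 add0r mulmxN.
Qed.

End Cone.

Lemma rank_ker_supported (K : fieldType) m p (B : 'M[K]_(m, p)) (Q : pred 'I_m) :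
  (forall z : 'rV_m, z *m B = 0 <-> forall q, ~~ Q q -> z 0 q = 0) ->
  \rank (kermx B) = #|Q|.
Proof.
move=> kerB; pose E : 'M[K]_(#|Q|, m) := \matrix_(a, q) (enum_val a == q)%:R.
have EE : E *m E^T = 1%:M.
  apply/matrixP => a b; rewrite !mxE (bigD1 (enum_val a)) //= !mxE eqxx mul1r.
  rewrite big1 => [|q qa]; last by rewrite mxE eq_sym (negbTE qa) mul0r.
  by rewrite addr0 (inj_eq enum_val_inj) eq_sym.
have freeE : row_free E by apply/row_freeP; exists E^T.
rewrite -(eqP freeE); apply/eqmx_rank/andP; split; apply/rV_subP => z.
  move=> /sub_kermxP/kerB zQ; apply/submxP; exists (\row_a z 0 (enum_val a)).
  apply/rowP => q; rewrite !mxE; have [Qq|/[dup] /zQ -> nQ] := boolP (Q q).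
    rewrite (bigD1 (enum_rank_in (A := Q) Qq q)) //= !mxE enum_rankK_in // eqxx.
    rewrite mulr1 big1 ?addr0 // => a aq; rewrite !mxE; case: eqP => [e|]; last by rewrite mulr0.
    by case/eqP: aq; apply: enum_val_inj; rewrite enum_rankK_in.
  rewrite big1 // => a _; rewrite !mxE; case: eqP => [e|]; last by rewrite mulr0.
  by have := enum_valP a; rewrite e => Qq; case/negP: nQ.
move=> /submxP[y ->]; apply/sub_kermxP/kerB => q nQ; rewrite mxE big1 // => a _.
rewrite mxE; case: eqP => [e|]; last by rewrite mulr0.
by have := enum_valP a; rewrite e => Qq; case/negP: nQ.
Qed.

(** * Tor of the Stanley-Reisner ring *)

Section BettiNumbers.
Variables (n k : nat) (F G : 'I_k -> {set 'I_n}) (P : 'I_k -> 'I_k).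
Hypothesis Plt : forall b : 'I_k, (0 < b)%N -> (P b < b)%N.
Hypothesis GF : forall b : 'I_k, (0 < b)%N -> G b \subset F b.
Hypothesis GP : forall b : 'I_k, (0 < b)%N -> G b \subset F (P b).
Hypothesis capG : forall a b : 'I_k, (a < b)%N -> F a :&: F b \subset G b.
Hypothesis cov : forall v, exists a, v \in F a.
Variables (K : fieldType) (D : scomplex n).
Hypothesis DF : forall s : {set 'I_n}, s \in faces D <-> exists a, s \subset F a.
Variable Fr : free_resolution K D.

Local Notation N i := #|gvalid F G i|.
Local Notation B i := (gmx F G P (fun=> 0 : K) i).

Definition ncells i (e : bool) := (\sum_(t | gvalid F G i t && (t.1.1 == e)) 1)%N.

Lemma ncellsE i : N i = (ncells i true + ncells i false)%N.
Proof.
rewrite -sum1_card (bigID (fun t : gidx n k => t.1.1 == true)) /=.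
by congr (_ + _)%N; apply: eq_bigl => t; case: t.1.1.
Qed.

Lemma ncells_sum i e : ncells i e =
  (\sum_(a < k) #|[set U | gvalid F G i (e, a, U)]|)%N.
Proof.
rewrite /ncells; under [RHS]eq_bigr => a _ do rewrite -sum1_card.
rewrite pair_big_dep /= [RHS](reindex_onto (fun t : gidx n k => (t.1.2, t.2))
  (fun p => (e, p.1, p.2))) /=; last by case.
apply: eq_big => // -[[e' a] U] /=; rewrite !inE /= !xpair_eqE !eqxx !andbT.
by case: (eqVneq e' e) => [->|_]; rewrite ?eqxx ?andbF.
Qed.

Lemma ncells_nodes i : ncells i.+1 false = (\sum_(a < k) 'C(#|~: F a|, i))%N.
Proof.
rewrite ncells_sum; apply: eq_bigr => a _; rewrite -cards_draws.
by apply: eq_card => U; rewrite !inE /gvalid /= eqSS andbC.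
Qed.

Lemma ncells_edges i :
  ncells i true = (\sum_(a < k | (0 < a)%N) 'C(#|~: G a|, i))%N.
Proof.
rewrite ncells_sum [RHS]big_mkcond; apply: eq_bigr => a _; case: ifP => a0.
  by rewrite -cards_draws; apply: eq_card => U; rewrite !inE /gvalid /= a0 andbC.
by apply/eqP; rewrite cards_eq0; apply/eqP/setP => U; rewrite !inE /gvalid /= a0 andbF.
Qed.

(** With the variables at 0 every edge maps to 0. From degree 2 on the nodes have nonempty U, and
    there the incidence map is injective on them. *)
Lemma ker_gmx0 i (z : 'rV_(N i.+2)) :
  z *m B i.+1 = 0 <-> forall q, ~~ (enum_val q).1.1 -> z 0 q = 0.
Proof.
split=> [/gmx_cycle e q|h].
  have := gD_nodes_inj Plt cov (gfun_supp z) (e GF GP).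
  move=> h nq; rewrite -(gfunK z) mxE; move: nq.
  by case: (enum_val q) => -[[] a] U.
apply: gfun_eq0 => t; rewrite gfun_mul //.
have g0 a U : gfun z (false, a, U) = 0.
  rewrite /gfun big1 // => q _; case: eqP => [e|]; last by rewrite mulr0.
  by rewrite h ?mul0r // -e.
have kd00 c U : kd (fun=> 0 : K) c U = 0 :> K.
  by rewrite /kd big1 // => j _; rewrite mulr0 mul0r.
by rewrite /gD !kd00 !g0 !subr0 !if_same.
Qed.

Lemma rank_ker_gmx0 i : \rank (kermx (B i.+1)) = ncells i.+2 true.
Proof.
rewrite (rank_ker_supported (Q := fun q => (enum_val q).1.1) (@ker_gmx0 i)).
rewrite -[LHS]sum1_card /ncells.
rewrite [RHS](eq_bigl (fun t => (t \in gvalid F G i.+2) && t.1.1)); last first.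
  by move=> t; rewrite eqb_id.
rewrite big_mkcondr [RHS]big_enum_val /= [LHS]big_mkcond.
by apply: eq_bigr => q _.
Qed.

Lemma rank_gmx0 i : \rank (B i.+1) = ncells i.+2 false.
Proof.
apply/eqP; rewrite -(eqn_add2r (\rank (kermx (B i.+1)))) mxrank_ker.
rewrite subnKC ?rank_leq_row // -(mxrank_ker (B i.+1)) rank_ker_gmx0.
by rewrite ncellsE addnC.
Qed.

Lemma gmx0_sub_ker i : (B i.+1 <= kermx (B i))%MS.
Proof. by apply/sub_kermxP; apply: gmx_gmx. Qed.

Lemma ncells_le i : (ncells i.+3 false <= ncells i.+2 true)%N.
Proof. by rewrite -rank_ker_gmx0 -rank_gmx0 mxrankS // gmx0_sub_ker. Qed.

Lemma tor_compK i j : tor_comp Fr i j *m tor_comp Fr i j = tor_comp Fr i j.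
Proof.
rewrite /tor_comp mulmx_diag; congr diag_mx; apply/rowP => l; rewrite !mxE.
by case: eqP => _; rewrite ?mulr1 ?mulr0.
Qed.

Lemma tor_comp_sub i j (u : 'rV_(fr_rank Fr i)) :
  (u <= tor_comp Fr i j)%MS -> u *m tor_comp Fr i j = u.
Proof. by move=> /submxP[w ->]; rewrite -mulmxA tor_compK. Qed.

Lemma tor_comp_diff i j :
  tor_comp Fr i.+1 j *m tor_diff Fr i = tor_diff Fr i *m tor_comp Fr i j.
Proof.
apply/matrixP => l m; rewrite /tor_comp mul_diag_mx mul_mx_diag !mxE.
have [->|ne] := eqVneq ((fr_diff Fr i l m)@_0%MM) 0; first by rewrite mulr0 mul0r.
have /(homog_of_mcoeff0 (@fr_diff_homog _ _ _ Fr i l m))/eqP := ne.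
by rewrite subr_eq0 => /eqP ->; rewrite mulrC.
Qed.

Lemma tor_diff_diff i : tor_diff Fr i.+1 *m tor_diff Fr i = 0.
Proof. by rewrite /tor_diff -map_mxM fr_diff_diff map_mx0. Qed.

(** The comparison identifies Tor_(i+1) with the homology over K of the gluing complex in degree i +
    2: edge cells modulo the image of the node cells one degree higher. All these edges have #|U| =
    i + 2, hence a single internal degree. *)
Lemma gbettiE i (j : int) : gbetti Fr i.+1 j =
  if j == i.+2%:Z then (ncells i.+2 true - ncells i.+3 false)%N else 0%N.
Proof.
have [A [Adeg Acyc Ainj Abd Asurj]] := comparison_over_field Plt GF GP capG DF Fr i.
rewrite /gbetti /tor_cycles -/(tor_comp Fr i.+1 j).
(* [C] consists of the cycles of internal degree j, and [W] sends them to the gluing complex modulo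
   boundaries. The kernel of [W] on [C] is made of the boundaries, so the Betti number is the rank
   of [C *m W]. *)
set C := (_ :&: _)%MS; pose W := A *m cokermx (B i.+2).
have CP (u : 'rV_(fr_rank Fr i.+1)) : (u <= C)%MS <->
    u *m tor_comp Fr i.+1 j = u /\ u *m tor_diff Fr i = 0.
  rewrite /C sub_capmx; split.
    by move=> /andP[/tor_comp_sub uj /sub_kermxP].
  move=> [uj ud]; apply/andP; split; last exact/sub_kermxP.
  by rewrite -uj submxMl.
have -> : \rank (tor_boundaries Fr i.+1 j) = \rank (C :&: kermx W)%MS.
  apply/eqmx_rank/andP; split; apply/rV_subP => u.
    move=> /submxP[w]; rewrite /tor_boundaries tor_comp_diff => ue.
    rewrite sub_capmx; apply/andP; split.
      apply/CP; split; first by rewrite ue -!mulmxA tor_compK.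
      by rewrite ue -mulmxA -tor_comp_diff -mulmxA tor_diff_diff !mulmx0.
    apply/sub_kermxP; rewrite /W mulmxA.
    have [x ->] : exists x, u *m A = x *m B i.+2.
      have [x xe] := Abd (w *m tor_comp Fr i.+2 j); exists x.
      by rewrite -xe ue -tor_comp_diff mulmxA.
    by rewrite -mulmxA mulmx_coker mulmx0.
  rewrite sub_capmx => /andP[/CP[uj ud] /sub_kermxP]; rewrite /W mulmxA => uW.
  have /submxP[x xe] : (u *m A <= B i.+2)%MS by rewrite submxE uW.
  have [v ve] := Ainj u x ud xe.
  apply/submxP; exists v; rewrite /tor_boundaries tor_comp_diff mulmxA -ve.
  by rewrite uj.
rewrite -(mxrank_mul_ker C W) addnK; case: eqP => [je|jne]; last first.
  apply/eqP; rewrite mxrank_eq0; apply/eqP/row_matrixP => l; rewrite row_mul row0.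
  have /CP[uj ud] := row_sub l C; rewrite /W mulmxA.
  suff -> : row l C *m A = 0 by rewrite mul0mx.
  have /ker_gmx0 nz := Acyc _ ud; apply/rowP => q; rewrite [RHS]mxE.
  have [eq1|/nz //] := boolP (enum_val q).1.1.
  rewrite -uj mxE big1 // => m _; rewrite mul_mx_diag !mxE.
  have [Am|/Adeg dm] := eqVneq (A m q) 0; first by rewrite Am mulr0.
  case: eqP => [mj|]; last by rewrite mulr0 mul0r.
  case: jne; rewrite -mj dm /gdeg; have : gvalid F G i.+2 (enum_val q) := enum_valP q.
  by rewrite /gvalid eq1 => /and3P[/eqP ->].
have eZ : (C *m A + B i.+2 :=: kermx (B i.+1))%MS.
  apply/eqmxP/andP; split.
    rewrite addsmx_sub gmx0_sub_ker // andbT; apply/row_subP => l.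
    by have /CP[_ ud] := row_sub l C; rewrite row_mul; apply/sub_kermxP/Acyc.
  apply/rV_subP => z /sub_kermxP zB; have [x [v [ze vd]]] := Asurj z zB.
  (* Cutting v down to degree j does not change its image: [A] preserves degrees, cycles only reach
     edges, and all edges here have degree j. *)
  pose v' := v *m tor_comp Fr i.+1 j.
  have v'C : (v' <= C)%MS.
    apply/CP; split; first by rewrite -mulmxA tor_compK.
    by rewrite -mulmxA tor_comp_diff mulmxA vd mul0mx.
  have -> : z = v' *m A + x *m B i.+2.
    rewrite ze addrC; congr (_ + _); apply/rowP => q.
    have [eq1|nq] := boolP (enum_val q).1.1; last first.
      have /ker_gmx0 -> // := Acyc _ vd.
      by have /CP[_ /Acyc/ker_gmx0 ->] := v'C.
    rewrite !mxE; apply: eq_bigr => m _; rewrite /v' mul_mx_diag !mxE.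
    have [->|/Adeg dm] := eqVneq (A m q) 0; first by rewrite !mulr0.
    suff -> : fr_deg m == j by rewrite mulr1.
    rewrite je dm /gdeg; have : gvalid F G i.+2 (enum_val q) := enum_valP q.
    by rewrite /gvalid eq1 => /and3P[/eqP ->].
  apply: addmx_sub_adds; last exact: submxMl.
  exact: submxMr.
rewrite -rank_ker_gmx0 -rank_gmx0 -eZ.
have -> : \rank (C *m W) = \rank ((C *m A + B i.+2)%MS *m cokermx (B i.+2)).
  by rewrite addsmxMr mulmx_coker addsmx0 /W mulmxA.
have <- := mxrank_mul_ker (C *m A + B i.+2)%MS (cokermx (B i.+2)).
suff -> : \rank ((C *m A + B i.+2) :&: kermx (cokermx (B i.+2)))%MS = \rank (B i.+2).
  by rewrite addnK.
apply/eqmx_rank/andP; split; apply/rV_subP => u.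
  by rewrite sub_capmx => /andP[_ /sub_kermxP uc]; rewrite submxE uc.
move=> uB; rewrite sub_capmx (submx_trans uB (addsmxSr _ _)) /=.
by apply/sub_kermxP/eqP; rewrite -submxE.
Qed.

End BettiNumbers.

(** * Depth *)

Section DepthUpperBound.
Variables (n : nat) (A : comNzRingType) (x : 'I_n -> A).

(* If y = sum_i a_i x_i, multiplication by y is null-homotopic on the Koszul
   complex. A class z that is nonzero modulo (s_1, ..., s_i) and killed by
   s_(i+1) thus gives one of degree one higher modulo (s_1, ..., s_(i+1)). *)
Lemma koszul_depth_bound (q : nat) (z : {set 'I_n} -> A) (s : seq A) :
  (forall U : {set 'I_n}, #|U| != q -> z U = 0) -> kd x z =1 (fun=> 0) ->
  ~ (exists u, z =1 kd x u) ->
  (forall y, y \in s -> exists a, y = \sum_i a i * x i) ->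
  regular_seq s -> (q + size s <= n)%N.
Proof.
move=> zq dz zN sx [sreg _].
have H i : (i <= size s)%N -> exists w : {set 'I_n} -> A,
    [/\ forall U : {set 'I_n}, #|U| != (q + i)%N -> w U = 0,
        forall U, in_ideal (take i s) (kd x w U)
      & ~ exists u, forall U, in_ideal (take i s) (w U - kd x u U)].
  elim: i => [|i IH] lti.
    exists z; rewrite take0 addn0; split=> // [U|[u uz]].
      by apply/in_ideal_nil; apply: dz.
    by apply: zN; exists u => U; have /in_ideal_nil/eqP := uz U;
      rewrite subr_eq0 => /eqP.
  have [w [wq dw wN]] := IH (ltnW lti); set y := s`_i.
  have [a ya] := sx y (mem_nth 0 lti).
  have hw (U : {set 'I_n}) : in_ideal (take i s) (kh a (kd x w) U).
    by apply: in_ideal_sum => j _; apply: in_idealM.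
  exists (kh a w); split.
  - move=> U Uq; rewrite /kh big1 // => j jU; rewrite wq ?mulr0 //.
    by apply: contraNN Uq => /eqP e; rewrite (cardsD1 j) jU e addnS.
  - move=> U; apply/(in_ideal_take _ lti).
    exists (- kh a (kd x w) U), (w U); first exact: in_idealN.
    by rewrite -/y ya mulrC -(kd_kh x a w U) addrC addrK.
  move=> [u uw].
  have /choice[v vP] U : exists c, in_ideal (take i s) (kh a w U - kd x u U - c * y).
    have /(in_ideal_take _ lti)[b [c sb ->]] := uw U.
    by exists c; rewrite addrK.
  apply: wN; exists v => U; apply: (sreg i lti).
  (* By the homotopy formula. Both terms on the right lie in the ideal of the first i elements, so
     the regularity of y makes w a boundary modulo that ideal. *)
  have -> : y * (w U - kd x v U) =
      kh a (kd x w) U + kd x (fun V => kh a w V - kd x u V - v V * y) U.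
    rewrite (eq_kd _ (c := fun V => kh a w V - kd x u V - v V * y)
      (c' := fun V => (kh a w V + -1 * kd x u V) + (- y) * v V));
      last by move=> V; rewrite mulN1r mulNr [y * _]mulrC.
    rewrite !kdD !kdZ kdd mulr0 addr0 addrA [kh _ _ _ + _]addrC kd_kh -ya.
    by rewrite mulrBr mulNr.
  apply: in_idealD => //; apply: in_ideal_sum => j _; exact: in_idealM.
have [w [wq _ wN]] := H _ (leqnn _).
(* Above degree n there are no exterior monomials, so the nonzero class would be 0. *)
rewrite leqNgt; apply/negP => lt_n; apply: wN; exists (fun=> 0) => U.
rewrite kd0 subr0 wq; first exact: in_ideal0.
rewrite neq_ltn (leq_ltn_trans _ lt_n) // -[X in (_ <= X)%N]card_ord.
exact: max_card.
Qed.

End DepthUpperBound.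

(** * A Koszul class from a disconnected restriction *)

Section DisconnectedClass.
Variables (K : fieldType) (n : nat) (D : scomplex n) (W1 W2 : {set 'I_n}).
Hypothesis dis : W1 :&: W2 = set0.
Hypothesis noedge : forall v w, v \in W1 -> w \in W2 -> [set v; w] \notin faces D.
Variables (w1 w2 : 'I_n).
Hypotheses (w1W : w1 \in W1) (w2W : w2 \in W2).

Local Notation R := (SR_ring K D).
Let W := W1 :|: W2.
Let x (i : 'I_n) : R := SR_pi D 'X_i.
Let x' (i : 'I_n) : R := if i \in W1 then x i else 0.
Let eW (U : {set 'I_n}) : R := (U == W)%:R.

Lemma SR_noedge v w : v \in W1 -> w \in W2 -> x w * x v = 0.
Proof.
move=> vW wW; rewrite /x -rmorphM; apply/SR_pi_eq0 => m mD.
rewrite -mpolyXD mcoeffX; case: (eqVneq (U_(w) + U_(v))%MM m) => // e.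
by have := noedge vW wW; rewrite setUC -!msupU -msupD e mD.
Qed.

(** The class is the part of the differential of e_W that comes from W1. It is a cycle because
    products of a variable of W1 with one of W2 are 0. Hochster's formula attaches it to the
    disconnected restriction of D to W. *)
Lemma SR_koszul_class : exists z : {set 'I_n} -> R,
  [/\ forall U : {set 'I_n}, #|U| != #|W|.-1 -> z U = 0, kd x z =1 (fun=> 0)
    & ~ exists u, z =1 kd x u].
Proof.
exists (kd x' eW); split.
- move=> U UW; rewrite /kd big1 // => i iU; rewrite /eW.
  case: (i |: U =P W) => [e|_]; last by rewrite mulr0.
  by rewrite -e cardsU1 iU eqxx in UW.
- move=> U; rewrite -[RHS](kdd x' eW U); apply: eq_bigr => i iU.
  rewrite /kd !mulr_sumr; apply: eq_bigr => j; rewrite !inE negb_or => /andP[ji jU].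
  rewrite /x'; case: (boolP (i \in W1)) => // iW; case: ifP => jW; last first.
    by rewrite !(mulr0, mul0r).
  rewrite /eW; case: (j |: (i |: U) =P W) => [e|_]; last by rewrite !mulr0.
  have : i \in W by rewrite -e !inE eqxx orbT.
  rewrite inE (negbTE iW) /= => iW2; rewrite mulr1 !mulr0 mul0r.
  by rewrite mulrCA -mulrA SR_noedge ?mulr0 // mulr0.
move=> [u ue]; have /choice[p pE] U : exists p, u U = SR_pi D p.
  exact: SR_pi_surj.
(* If the class is the boundary of u, comparing coefficients of x_w at W minus w shows that the
   constant term of u(W) is 1 for w in W1 and 0 for w in W2. *)
have key w : w \in W -> (p W)@_0%MM = (w \in W1)%:R.
  move=> wW; pose U0 := W :\ w; have wU0 : w \notin U0 by rewrite !inE eqxx.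
  have := ue U0; rewrite /kd (bigD1 w) //= big1 ?addr0; last first.
    move=> i /andP[_ iw]; rewrite /eW; case: (i |: U0 =P W) => [e|_]; last by rewrite mulr0.
    have : w \in i |: U0 by rewrite e.
    by rewrite !inE eqxx /= orbF eq_sym (negbTE iw).
  rewrite {1}/eW setD1K // eqxx mulr1 /x'.
  have sgE i (U : {set 'I_n}) : ksg R i U = SR_pi D (ksg {mpoly K[n]} i U).
    by rewrite /ksg rmorphXn rmorphN1.
  have -> : (if w \in W1 then x w else 0) = SR_pi D ((w \in W1)%:R * 'X_w).
    by case: ifP => _; rewrite ?mul1r // mul0r rmorph0.
  under eq_bigr => i _ do rewrite pE /x sgE -!rmorphM.
  rewrite sgE -rmorphM -rmorph_sum => /eqP.
  rewrite -subr_eq0 -rmorphB => /eqP /SR_pi_eq0 /(_ U_(w)%MM).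
  rewrite msupU vertex_face => /(_ isT)/eqP; rewrite mcoeffB subr_eq0.
  rewrite raddf_sum (bigD1 w) //= big1 ?addr0; last first.
    move=> i /andP[_ iw]; rewrite mulrAC.
    rewrite mcoeffM big1 // => -[a b] /= /eqP e; rewrite mcoeffX.
    case: eqP => [bi|]; last by rewrite mulr0.
    have /mnmP/(_ i) := e; rewrite mnmDE -bi !mnm1E eqxx eq_sym (negbTE iw).
    by rewrite addn1.
  have sgC i (U : {set 'I_n}) (q : {mpoly K[n]}) m :
      (ksg {mpoly K[n]} i U * q)@_m = ksg K i U * q@_m.
    rewrite /ksg -signr_odd -[in RHS]signr_odd; case: odd.
      by rewrite !expr1 !mulN1r mcoeffN.
    by rewrite !expr0 !mul1r.
  rewrite -mulrA !sgC => /eqP /(congr1 (fun a => ksg K w U0 * a)).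
  rewrite !mulrA ksg_sq !mul1r setD1K // => e.
  have := mcoeffMX (p W) U_(w)%MM 0%MM; rewrite addm0 mulrC -e => <-.
  by case: (w \in W1); rewrite ?mul1r ?mul0r ?mcoeff0 // mcoeffX eqxx.
have w2N : (w2 \in W1) = false.
  by apply/negP => h; have := in_set0 w2; rewrite -dis inE h w2W.
have := key w1; rewrite (key w2); last by rewrite inE w2W orbT.
rewrite w2N w1W inE w1W => /(_ isT)/eqP.
by rewrite eq_sym oner_eq0.
Qed.

Lemma SR_max_sum a : SR_max a -> exists c : 'I_n -> R, a = \sum_i c i * x i.
Proof.
move=> [c ->]; rewrite size_map size_enum_ord; exists (fun i => c i).
apply: eq_bigr => i _; rewrite (nth_map i) ?size_enum_ord //.
by rewrite nth_ord_enum.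
Qed.

Lemma SR_depth_le (s : seq R) : (forall y, y \in s -> SR_max y) ->
  regular_seq s -> (#|W|.-1 + size s <= n)%N.
Proof.
move=> sm sreg; have [z [zW dz zN]] := SR_koszul_class.
apply: (koszul_depth_bound zW dz zN) sreg => y /sm.
exact: SR_max_sum.
Qed.

End DisconnectedClass.

(** * Regularity of the elementary symmetric polynomials *)

Section RegularSymmetric.
Variables (K : fieldType) (n : nat).
Local Notation S := {mpoly K[n]}.
Implicit Types (p q g y : S) (s : seq S) (F : {set 'I_n}) (D : {set {set 'I_n}}).

(** Quotients by [D] and [s] are handled as ideals of S, so that one sequence can be compared modulo
    several complexes. *)
Definition vmod D s p := exists2 a, van D a & in_ideal s (p - a).

Definition vreg D s y := forall g, vmod D s (y * g) -> vmod D s g.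

Lemma vmod_van D s p : van D p -> vmod D s p.
Proof. by exists p => //; rewrite subrr; apply: in_ideal0. Qed.

Lemma vmod_ideal D s p : in_ideal s p -> vmod D s p.
Proof. by exists 0; [apply: van0|rewrite subr0]. Qed.

Lemma vmodD D s p q : vmod D s p -> vmod D s q -> vmod D s (p + q).
Proof.
move=> [a Da sa] [b Db sb]; exists (a + b); first exact: vanD.
by rewrite opprD addrACA; apply: in_idealD.
Qed.

Lemma vmodM D s p q : down_closed D -> vmod D s q -> vmod D s (p * q).
Proof.
move=> dD [a Da sa]; exists (p * a); first exact: vanM.
by rewrite -mulrBr; apply: in_idealM.
Qed.

Lemma vmodN D s p : vmod D s p -> vmod D s (- p).
Proof.
move=> [a Da sa]; exists (- a); first exact: vanN.
by rewrite -opprD; apply: in_idealN.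
Qed.

Lemma vmodB D s p q : vmod D s p -> vmod D s q -> vmod D s (p - q).
Proof. by move=> h /vmodN; apply: vmodD. Qed.

Lemma vmod_sum D s (I : Type) (r : seq I) (P : pred I) (f : I -> S) :
  (forall i, P i -> vmod D s (f i)) -> vmod D s (\sum_(i <- r | P i) f i).
Proof.
move=> h; elim/big_ind: _ => //; last exact: vmodD.
by apply: vmod_ideal; apply: in_ideal0.
Qed.

Lemma vmod_sub D D' s p : D' \subset D -> vmod D s p -> vmod D' s p.
Proof. by move=> sD [a Da sa]; exists a => //; apply: van_sub Da. Qed.

Lemma vmod_rcons D s y p :
  vmod D (rcons s y) p <-> exists a, exists2 c, vmod D s a & p = a + c * y.
Proof.
split.
  move=> [a Da /in_ideal_rcons[b [c sb e]]]; exists (a + b), c.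
    by exists a => //; rewrite addrC addKr.
  by rewrite -addrA -e addrC subrK.
move=> [b [c [a Da sa] ->]]; exists a => //; apply/in_ideal_rcons.
by exists (b - a), c; rewrite // addrAC.
Qed.

Definition esyms j : seq S := mkseq (fun i => mesym n K i.+1) j.

Lemma esymsS j : esyms j.+1 = rcons (esyms j) (mesym n K j.+1).
Proof. exact: mkseqS. Qed.

Lemma mesym_homog_of j : homog_of j%:Z (mesym n K j).
Proof. by move=> m /(dhomog_mf (dhomog_mesym _ _ _)) ->. Qed.

Lemma van_hcomp D z p : van D p -> van D (hcomp z p).
Proof. by move=> h m mD; rewrite mcoeff_hcomp h // if_same. Qed.

Lemma vmod_hcomp D j z p : vmod D (esyms j) p -> vmod D (esyms j) (hcomp z p).
Proof.
move=> [a Da [c e]]; rewrite -(subrK a p) addrC hcompD.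
apply: vmodD; first by apply: vmod_van; apply: van_hcomp.
rewrite e hcomp_sum; apply: vmod_ideal.
exists (fun i => hcomp (z - i.+1%:Z) (c i)); apply: eq_bigr => i _.
have ij : (i < j)%N by have := ltn_ord i; rewrite {2}size_mkseq.
by rewrite nth_mkseq // (hcompM _ _ (@mesym_homog_of i.+1)).
Qed.

Lemma sum_hcomp p : p = \sum_(d < msize p) hcomp d%:Z p.
Proof.
apply/mpolyP => m; rewrite raddf_sum /=.
under eq_bigr => d _ do rewrite mcoeff_hcomp.
have [mp|mNp] := boolP (m \in msupp p); last first.
  by rewrite memN_msupp_eq0 // big1 // => d _; rewrite if_same.
rewrite (bigD1 (Ordinal (msize_mdeg_lt mp))) //= eqxx big1 ?addr0 // => d.
by rewrite -val_eqE /= eq_sym => /negbTE ne; rewrite eqz_nat ne.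
Qed.

(** If X_v g = a + c y, then c = b + h X_v by the regularity of y modulo X_v, and X_v (g - h y) = a
    + y b. *)
Lemma vreg_swapX D s y v : down_closed D ->
  vreg D s 'X_v -> (forall g, vmod D (rcons s 'X_v) (y * g) -> vmod D (rcons s 'X_v) g) ->
  vreg D (rcons s y) 'X_v.
Proof.
move=> dD regX regy g /vmod_rcons[a [c sa e]].
have /regy/vmod_rcons[b [h sb ch]] : vmod D (rcons s 'X_v) (y * c).
  apply/vmod_rcons; exists (- a), g; first exact: vmodN.
  by rewrite addrC mulrC [g * _]mulrC e addrC addKr.
apply/vmod_rcons; exists (g - h * y), h; last by rewrite subrK.
apply: regX; have -> : 'X_v * (g - h * y) = a + y * b.
  by rewrite mulrBr e ch mulrDl -addrA; congr (_ + _); rewrite [y * b]mulrC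
    mulrA ['X_v * h]mulrC addrK.
by apply: vmodD => //; apply: vmodM.
Qed.

(* Graded Nakayama: a variable that is regular modulo D + (s) detects the
   regularity of the next symmetric polynomial. *)
Lemma vreg_mesym_lift D j v : down_closed D ->
  vreg D (esyms j) 'X_v ->
  (forall g, vmod D (rcons (esyms j) 'X_v) (mesym n K j.+1 * g) ->
     vmod D (rcons (esyms j) 'X_v) g) ->
  vreg D (esyms j) (mesym n K j.+1).
Proof.
move=> dD regX regy; set y := mesym n K j.+1 in regy *.
(* Repeated division by X_v: for every m, g lies in the ideal plus (X_v^m), with a cofactor that is
   again killed by y. *)
have pow m g : vmod D (esyms j) (y * g) ->
    exists2 a, vmod D (esyms j) a & exists2 c, vmod D (esyms j) (y * c)
      & g = a + c * 'X_v ^+ m.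
  elim: m => [|m IH] yg.
    exists 0; first by apply: vmod_ideal; apply: in_ideal0.
    by exists g; rewrite // expr0 mulr1 add0r.
  have [a sa [c yc ->]] := IH yg.
  have /regy/vmod_rcons[b [h sb ce]] : vmod D (rcons (esyms j) 'X_v) (y * c).
    by apply/vmod_rcons; exists (y * c), 0; rewrite ?mul0r ?addr0.
  exists (a + b * 'X_v ^+ m).
    by apply: vmodD => //; rewrite mulrC; apply: vmodM.
  exists h; last by rewrite ce mulrDl -mulrA -exprS addrA.
  apply: regX; have -> : 'X_v * (y * h) = y * c - y * b.
    by rewrite ce; ring.
  by apply: vmodB => //; apply: vmodM.
move=> g yg; rewrite [g]sum_hcomp; apply: vmod_sum => d _.
(* In degree d the power d + 1 leaves no room for the cofactor, whose component would have degree
   -1. *)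
have [|a sa [c _ e]] := pow d.+1 (hcomp d%:Z g).
  rewrite mulrC -[d%:Z](addrK j.+1%:Z) -(hcompM _ _ (@mesym_homog_of j.+1)) mulrC.
  exact: vmod_hcomp.
rewrite -(hcomp_id (@hcomp_homog K n d%:Z g)) e hcompD.
apply: vmodD; first exact: vmod_hcomp.
have Xh : homog_of d.+1%:Z ('X_v ^+ d.+1 : S).
  move=> m; rewrite mpolyXn => /mem_msuppXP <-.
  by rewrite mdegMn mdeg1 mul1n.
rewrite (hcompM _ _ Xh); suff -> : hcomp (d%:Z - d.+1%:Z) c = 0.
  by rewrite mul0r; apply: vmod_ideal; apply: in_ideal0.
apply/mpolyP => m; rewrite mcoeff_hcomp mcoeff0 ifN //.
by rewrite -addn1 PoszD opprD addrA subrr add0r.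
Qed.

Lemma vmod_powersetD1 F v s p : v \in F ->
  vmod (powerset (F :\ v)) s p <-> vmod (powerset F) (rcons s 'X_v) p.
Proof.
move=> vF; split.
  move=> [a Da sa]; apply/vmod_rcons; have [c ac] := van_gen Da.
  exists (p - c v * 'X_v), (c v); last by rewrite subrK.
  exists (a - c v * 'X_v); last by rewrite opprB addrA subrK.
  rewrite ac (bigD1 v) /=; last by rewrite !inE eqxx.
  rewrite mulrC addrAC subrr add0r; apply: van_sum => i.
  rewrite !inE negb_and negbK => /andP[/predU1P[->|iF] iv]; first by rewrite eqxx in iv.
  rewrite mulrC; apply: vanM; first exact: down_closed_powerset.
  exact: vanX.
move=> /vmod_rcons[a [c [b Db sb] ->]]; exists (b + c * 'X_v); last first.
  by rewrite opprD addrACA subrr addr0.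
apply: vanD; first by apply: van_sub Db; rewrite powersetS subD1set.
apply: vanM; first exact: down_closed_powerset.
by apply: vanX; rewrite !inE eqxx.
Qed.

Lemma vreg_prod D s (I : Type) (r : seq I) (P : pred I) (f : I -> S) :
  (forall i, P i -> vreg D s (f i)) -> vreg D s (\prod_(i <- r | P i) f i).
Proof.
move=> h; elim/big_ind: _ => // [g|a b ra rb g]; first by rewrite mul1r.
by rewrite -mulrA => /ra/rb.
Qed.

(** [F] is the only subset of its size inside [F]. *)
Lemma mesym_top F : van (powerset F) (mesym n K #|F| - \prod_(i in F) 'X_i).
Proof.
have -> : \prod_(i in F) 'X_i = 'X_[mesym1 F] :> S by rewrite -sqfree_monE.
rewrite mesymE (bigD1 F) //= addrAC subrr add0r; apply: van_sum => h /andP[/eqP hF ne].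
move=> m; rewrite powersetE mcoeffX; case: eqP => // <-; rewrite msup_mesym1.
by move=> hsF; case/eqP: ne; apply/eqP; rewrite eqEcard hsF hF leqnn.
Qed.

(** Induction on F. Killing X_v deletes v, so for j + 1 < #|F| the claim lifts from F minus v by
    graded Nakayama, where X_v is regular by [vreg_swapX]. The last symmetric polynomial is the
    product of the variables of F, each regular modulo the preceding ones. *)
Lemma vreg_facet F j : (j < #|F|)%N ->
  vreg (powerset F) (esyms j) (mesym n K j.+1).
Proof.
have [N] := ubnP #|F|; elim: N => // N IH in F j *; rewrite ltnS => FN jF.
have dF := @down_closed_powerset n F.
have IH' v i : v \in F -> (i < #|F|.-1)%N -> forall g,
    vmod (powerset F) (rcons (esyms i) 'X_v) (mesym n K i.+1 * g) ->
    vmod (powerset F) (rcons (esyms i) 'X_v) g.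
  move=> vF; rewrite (cardsD1 v F) vF => iF g.
  move=> /(vmod_powersetD1 _ _ vF) h; apply/(vmod_powersetD1 _ _ vF); apply: IH iF _ h.
  by apply: leq_trans FN; rewrite (cardsD1 v F) vF.
have regX v i : v \in F -> (i <= #|F|.-1)%N -> vreg (powerset F) (esyms i) 'X_v.
  move=> vF; elim: i => [|i IHi] iF.
    move=> g [a Da /in_ideal_nil/eqP]; rewrite subr_eq0 => /eqP e.
    by apply: vmod_van; apply: (van_mulX vF); rewrite e.
  rewrite esymsS; apply: vreg_swapX => //; first exact: (IHi (ltnW iF)).
  exact: IH'.
have [jlt|] := boolP (j < #|F|.-1)%N.
  have [v vF] : exists v, v \in F by apply/card_gt0P; apply: leq_ltn_trans jF.
  by apply: (@vreg_mesym_lift _ _ v) => //; [apply: regX (ltnW _)|apply: IH'].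
rewrite -leqNgt => lej; have ej : #|F| = j.+1.
  apply/eqP; rewrite eqn_leq jF andbT; apply: leq_trans (leqSpred _) _.
  by rewrite ltnS.
move=> g h; apply: (@vreg_prod _ _ _ (index_enum 'I_n) (mem F) (fun i => 'X_i)).
  by move=> i iF; apply: regX => //; rewrite ej.
have := @mesym_top F; rewrite ej => top.
rewrite -(subKr (mesym n K j.+1) (\prod_(i in F) 'X_i)) mulrBl.
apply: vmodB => //; apply: vmod_van; rewrite mulrC; exact: vanM.
Qed.

(** Left exactness of the Mayer-Vietoris sequence modulo e_1, ..., e_j: it persists when one more
    e_i is divided out, provided that e_i is regular on the intersection. *)
Lemma vmod_glue D1 D2 j r1 : down_closed D1 -> down_closed D2 ->
  (forall i, (i < r1)%N -> vreg (D1 :&: D2) (esyms i) (mesym n K i.+1)) ->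
  (j <= r1)%N -> forall g,
  vmod D1 (esyms j) g -> vmod D2 (esyms j) g -> vmod (D1 :|: D2) (esyms j) g.
Proof.
move=> d1 d2 reg; elim: j => [|j IH] jr g.
  move=> [a Da /in_ideal_nil/eqP]; rewrite subr_eq0 => /eqP ->.
  move=> [b Db /in_ideal_nil/eqP]; rewrite subr_eq0 => /eqP e.
  by apply: vmod_van; apply/vanU; split=> //; rewrite e.
rewrite !esymsS; set y := mesym n K j.+1.
move=> /vmod_rcons[a [u sa ga]] /vmod_rcons[b [v sb gb]].
have /(reg _ jr)[c Dc sc] : vmod (D1 :&: D2) (esyms j) (y * (u - v)).
  have -> : y * (u - v) = b - a.
    have eb : b = g - v * y by rewrite gb addrK.
    have ea : a = g - u * y by rewrite ga addrK.
    by rewrite ea eb; ring.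
  by apply: vmodB; [apply: vmod_sub sb; apply: subsetIr|
    apply: vmod_sub sa; apply: subsetIl].
(* Modulo the e_i, the quotients u and v differ by a' + b'; moving a' to the side of D1 lets the
   single quotient u - a' serve both complexes. *)
have [a' [b' [Da' Db' cE]]] := vanI Dc.
pose e := u - v - c; have se : in_ideal (esyms j) e := sc.
apply/vmod_rcons; exists (g - (u - a') * y), (u - a'); last by rewrite subrK.
apply: IH (ltnW jr) _ _ _.
  have -> : g - (u - a') * y = a + y * a'.
    by rewrite ga; ring.
  by apply: vmodD => //; apply: vmodM => //; apply: vmod_van.
have -> : g - (u - a') * y = b - y * b' - y * e.
  have eb : b = g - v * y by rewrite gb addrK.
  by rewrite /e cE eb; ring.
apply: vmodB; last by apply: vmod_ideal; apply: in_idealM.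
by apply: vmodB => //; apply: vmodM => //; apply: vmod_van.
Qed.

End RegularSymmetric.

Section ForestDepth.
Variables (K : fieldType) (n : nat) (D : scomplex n) (k d1 r1 : nat).
Variables (F G : nat -> {set 'I_n}) (par : nat -> nat).
Hypothesis fd : forest_data k d1 r1 (faces D) F G par.
Hypotheses (k2 : (2 <= k)%N) (r1d1 : (r1 < d1)%N).
Local Notation S := {mpoly K[n]}.

Definition first_facets m : {set {set 'I_n}} :=
  [set s : {set 'I_n} | [exists a : 'I_m, s \subset F a]].

Lemma in_first_facets m (s : {set 'I_n}) :
  reflect (exists2 a, (a < m)%N & s \subset F a) (s \in first_facets m).
Proof.
rewrite inE; apply: (iffP existsP) => [[a sa]|[a am sa]]; first by exists a.
by exists (Ordinal am).
Qed.

Lemma first_facetsS m : first_facets m.+1 = first_facets m :|: powerset (F m).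
Proof.
apply/setP => s; rewrite in_setU powersetE; apply/in_first_facets/orP.
  move=> [a]; rewrite ltnS leq_eqVlt => /predU1P[-> | am]; first by right.
  by left; apply/in_first_facets; exists a.
by case=> [/in_first_facets[a am sa]|sm]; [exists a => //; apply: leqW|exists m].
Qed.

Lemma first_facets_glue m : (0 < m < k)%N ->
  first_facets m :&: powerset (F m) = powerset (G m).
Proof.
move=> mk; apply/setP => s; rewrite in_setI !powersetE; apply/andP/idP.
  move=> [/in_first_facets[a am sa] sm]; case/andP: mk => _ mk.
  by apply: subset_trans (glue_cap fd am mk); rewrite subsetI sa.
move=> sG; split; last exact: subset_trans (glue_sub fd mk).
apply/in_first_facets; exists (par m); first exact: (par_lt fd mk).
exact: subset_trans (glue_par fd mk).
Qed.

Lemma first_facets_all : first_facets k = faces D.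
Proof. by apply/setP => s; apply/in_first_facets/idP => /(faceP fd). Qed.

Lemma down_closed_first m : down_closed (first_facets m).
Proof.
move=> s s' /in_first_facets[a am sa] ss'; apply/in_first_facets.
by exists a => //; apply: subset_trans sa.
Qed.

Lemma vreg_first m j : (0 < m <= k)%N -> (j <= r1)%N ->
  vreg (first_facets m) (esyms K n j) (mesym n K j.+1).
Proof.
elim: m => // m IH in j *; move=> /andP[_ mk] jr.
have jF : (j < #|F m|)%N by rewrite (card_facet fd mk) (leq_ltn_trans jr).
have [m0|m0] := posnP m.
  have -> : first_facets m.+1 = powerset (F m).
    rewrite first_facetsS (_ : first_facets m = set0) ?set0U //.
    by apply/setP => s; rewrite in_set0; apply/negP => /in_first_facets[a]; rewrite m0.
  exact: vreg_facet.
have m0k : (0 < m < k)%N by rewrite m0.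
rewrite first_facetsS => g h.
apply: (@vmod_glue _ _ _ _ _ r1) => //.
- exact: down_closed_first.
- exact: down_closed_powerset.
- move=> i ir; rewrite first_facets_glue //; apply: vreg_facet.
  by rewrite (card_glue fd m0k).
- apply: (IH j) => //; first by rewrite m0 ltnW.
  by apply: vmod_sub h; apply: subsetUl.
- by apply: (@vreg_facet _ _ (F m) j) => //; apply: vmod_sub h; apply: subsetUr.
Qed.

Lemma in_ideal_SR (s : seq S) p :
  in_ideal (map (SR_pi D) s) (SR_pi D p) <-> vmod (faces D) s p.
Proof.
split.
  move=> [c]; rewrite size_map.
  have /choice[e eE] i : exists q, c i = SR_pi D q by apply: SR_pi_surj.
  under eq_bigr => i _ do rewrite eE (nth_map 0) // -rmorphM.
  rewrite -rmorph_sum => /eqP; rewrite -subr_eq0 -rmorphB => /eqP/SR_pi_eq0 h.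
  exists (p - \sum_(i < size s) e i * s`_i) => //.
  by rewrite subKr; exists e.
move=> [a /SR_pi_eq0 a0 [c e]]; exists (fun i => SR_pi D (c i)).
rewrite size_map; under eq_bigr => i _ do rewrite (nth_map 0) // -rmorphM.
by rewrite -rmorph_sum -e rmorphB /= a0 subr0.
Qed.

Lemma take_esyms i j : (i <= j)%N -> take i (esyms K n j) = esyms K n i.
Proof. by move=> ij; rewrite /esyms /mkseq -map_take take_iota (minn_idPl ij). Qed.

Lemma SR_max_mcoeff0 p : p@_0%MM = 0 -> SR_max (SR_pi D p : SR_ring K D).
Proof.
move=> p0; have /van_gen[c ->] : van (powerset set0) p.
  move=> m; rewrite powersetE subset0 => /eqP ms0.
  suff -> : m = 0%MM by [].
  apply/mnmP => i; rewrite mnm0E; apply/eqP; rewrite -[_ == _]negbK.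
  by have := in_set0 i; rewrite -ms0 inE => ->.
have cE : forall i : nat, exists q : S, forall j : 'I_n, val j = i -> q = c j.
  move=> i; have [lti|] := ltnP i n; last first.
    by move=> le; exists 0 => j ji; have := ltn_ord j; rewrite [val j]ji ltnNge le.
  by exists (c (Ordinal lti)) => j ji; congr c; apply: val_inj.
have /choice[e eE] := cE.
exists (fun i => SR_pi D (e i)); rewrite size_map size_enum_ord rmorph_sum.
apply: eq_big => [i|i _]; first by rewrite inE.
rewrite (nth_map i) ?size_enum_ord // nth_ord_enum rmorphM mulrC.
by rewrite (eE i i).
Qed.

Lemma SR_depth_ge : exists s : seq (SR_ring K D),
  [/\ size s = r1.+1, forall x, x \in s -> SR_max x & regular_seq s].
Proof.
have e0 i : (mesym n K i.+1)@_0%MM = 0.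
  by apply/(homog_ofP _ _).1; [exact: mesym_homog_of|rewrite mdeg0].
exists (map (SR_pi D) (esyms K n r1.+1)); split.
- by rewrite size_map size_mkseq.
- by move=> _ /mapP[_ /mapP[i _ ->] ->]; apply: SR_max_mcoeff0.
split.
  move=> i; rewrite size_map size_mkseq ltnS => ir g.
  have [p ->] := SR_pi_surj g.
  rewrite -map_take take_esyms 1?leqW // (nth_map 0) ?size_mkseq ?ltnS //.
  rewrite nth_mkseq ?ltnS // -rmorphM => /in_ideal_SR h; apply/in_ideal_SR.
  move: h; rewrite -first_facets_all; apply: vreg_first => //.
  by rewrite leqnn andbT (leq_trans _ k2).
rewrite -(rmorph1 (SR_pi D)) => /in_ideal_SR[a Da [c e]].
have /(congr1 (mcoeff 0%MM)) := e; rewrite mcoeffB mcoeff1 eqxx.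
rewrite Da ?msup0 ?set0_face // subr0 raddf_sum big1; last first.
  move=> i _; have ir : (i < r1.+1)%N by apply: leq_trans (ltn_ord i) _; rewrite size_mkseq.
  by rewrite [LHS]rmorphM /= nth_mkseq // e0 mulr0.
by move=> /eqP; rewrite oner_eq0.
Qed.

(** The last facet is taken because its gluing simplex contains its intersection with every other
    facet. Without that gluing simplex, the rest of the facet is separated from the vertices outside
    the facet. *)
Lemma SR_depth_upper (s : seq (SR_ring K D)) :
  (forall x, x \in s -> SR_max x) -> regular_seq s -> (size s <= r1.+1)%N.
Proof.
move=> sm sreg; pose b := k.-1.
have bk : (0 < b < k)%N by rewrite /b; case: (k) k2 => [|[|k']] //=; rewrite ltnSn.
pose W1 := F b :\: G b; pose W2 := ~: F b.
have dis : W1 :&: W2 = set0.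
  by apply/setP => v; rewrite !inE; case: (v \in F b); rewrite ?andbF.
have UW : W1 :|: W2 = ~: G b.
  apply/setP => v; rewrite !inE; have /subsetP/(_ v) := glue_sub fd bk.
  case: (v \in G b); case: (v \in F b) => //.
  by move=> /(_ isT).
have noedge v w : v \in W1 -> w \in W2 -> [set v; w] \notin faces D.
  rewrite !inE => /andP[vG vF] wF; apply/negP => /(faceP fd)[a ak].
  rewrite subUset !sub1set => /andP[va wa].
  have ab : (a < b)%N.
    rewrite ltn_neqAle; apply/andP; split.
      by apply: contraNneq wF => <-.
    by rewrite /b -ltnS prednK // (leq_trans _ k2).
  have /andP[_ bk'] := bk; have /subsetP/(_ v) := glue_cap fd ab bk'.
  by rewrite inE va vF (negbTE vG) => /(_ isT).
have [w1 w1W] : exists w, w \in W1.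
  apply/card_gt0P; rewrite cardsD (setIidPr (glue_sub fd bk)).
  have /andP[_ bk'] := bk.
  by rewrite (card_glue fd bk) (card_facet fd bk') subn_gt0.
have [w2 w2W] : exists w, w \in W2.
  have /andP[b0 bk'] := bk; have k0 : (0 < k)%N by apply: leq_trans k2.
  have : ~~ (F 0 \subset F b).
    apply/negP => F0b; have := subset_leq_card (glue_cap fd b0 bk').
    by rewrite (setIidPl F0b) (card_facet fd k0) (card_glue fd bk) leqNgt r1d1.
  by case/subsetPn => w _ wF; exists w; rewrite inE.
have := SR_depth_le dis noedge w1W w2W sm sreg.
rewrite UW cardsCs setCK card_ord (card_glue fd bk) -ltnS.
have r1lt : (r1 < n)%N.
  rewrite -(card_glue fd bk) -[X in (_ < X)%N]card_ord -cardsT.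
  apply: proper_card; rewrite properE subsetT /=; apply/subsetPn; exists w1 => //.
  by move: w1W; rewrite inE => /andP[].
by lia.
Qed.

End ForestDepth.

(** * Hilbert series *)

Section HilbertFunction.
Variable n : nat.
Implicit Types (F : {set 'I_n}) (D : {set {set 'I_n}}).

Definition face_monomials D j : {set 'X_{1..n < j.+1}} :=
  [set m : 'X_{1..n < j.+1} | (mdeg m == j) && (msup m \in D)].

Lemma face_monomialsUI D1 D2 j :
  (#|face_monomials (D1 :|: D2) j| + #|face_monomials (D1 :&: D2) j| =
   #|face_monomials D1 j| + #|face_monomials D2 j|)%N.
Proof.
have -> : face_monomials (D1 :|: D2) j = face_monomials D1 j :|: face_monomials D2 j.
  by apply/setP => m; rewrite !inE; case: (mdeg m == j).
have -> : face_monomials (D1 :&: D2) j = face_monomials D1 j :&: face_monomials D2 j.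
  by apply/setP => m; rewrite !inE; case: (mdeg m == j).
exact: cardsUI.
Qed.

Lemma mnm_shift_bound j v (m : 'X_{1..n < j.+1}) : (mdeg (m + U_(v))%MM < j.+2)%N.
Proof. by rewrite mdegD mdeg1 addn1 ltnS bmdeg. Qed.

(** Pascal's rule: a monomial of degree j + 1 either avoids v or is X_v times one of degree j. For F
    empty the truncated predecessor gives 1 if j = 0 and 0 otherwise, as r = -1 requires. *)
Lemma card_face_monomials F j :
  #|face_monomials (powerset F) j| = 'C((j + #|F|).-1, j).
Proof.
have [N] := ubnP (j + #|F|); elim: N => // N IH in F j *; rewrite ltnS => jN.
case: j => [|j] in jN *.
  rewrite bin0; suff -> : face_monomials (powerset F) 0 = [set @bm0 n 0] by rewrite cards1.
  apply/setP => m; rewrite !inE ?powersetE mdeg_eq0; apply/andP/eqP => [[/eqP m0 _]|->].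
    by apply: val_inj.
  by rewrite eqxx msup0 sub0set.
have [F0|[v vF]] := set_0Vmem F.
  rewrite F0 cards0 addn0 bin_small //; apply/eqP; rewrite cards_eq0.
  apply/eqP/setP => m; rewrite !inE ?powersetE subset0.
  apply/negbTE/negP => /andP[/eqP dm /eqP m0].
  have : bmnm m = 0%MM.
    apply/mnmP => i; rewrite mnm0E; apply/eqP; rewrite -[_ == _]negbK.
    by have := in_set0 i; rewrite -m0 inE => ->.
  by move=> e; rewrite e mdeg0 in dm.
pose sh (m : 'X_{1..n < j.+1}) := BMultinom (mnm_shift_bound v m).
have sh_inj : injective sh.
  by move=> m m' /(congr1 val) /= /addIm e; apply: val_inj.
have -> : face_monomials (powerset F) j.+1 =
    face_monomials (powerset (F :\ v)) j.+1 :|: [set sh m | m in face_monomials (powerset F) j].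
  apply/setP => m; rewrite !inE ?powersetE subsetD1; apply/idP/orP.
    move=> /andP[/eqP dm mF]; have [mv|mv] := boolP (v \in msup m); last first.
      by left; rewrite dm eqxx mF.
    have Um : (U_(v) <= m)%MM by rewrite lep1mP; move: mv; rewrite inE.
    have e := submK Um; have dm' : mdeg (m - U_(v))%MM = j.
      by apply/eqP; rewrite -eqSS -addn1 -(mdeg1 v) -mdegD e dm.
    have lt' : (mdeg (m - U_(v))%MM < j.+1)%N by rewrite dm'.
    right; apply/imsetP; exists (BMultinom lt').
      rewrite !inE ?powersetE /= dm' eqxx /=; apply: subset_trans mF.
      by rewrite -[in X in _ \subset X]e msupD subsetUl.
    by apply: val_inj; rewrite /= e.
  case=> [/and3P[-> -> _] //|/imsetP[m']]; rewrite !inE ?powersetE => /andP[/eqP dm mF] ->.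
  by rewrite /= mdegD dm mdeg1 addn1 eqxx msupD msupU subUset mF sub1set.
rewrite cardsU (_ : _ :&: _ = set0) ?cards0 ?subn0; last first.
  apply/setP => m; rewrite !inE; apply/negbTE/negP => /andP[/andP[_ ]].
  rewrite ?powersetE subsetD1 => /andP[_ vm] /imsetP[m' _ e].
  by case/negP: vm; rewrite e /= msupD msupU !inE eqxx orbT.
rewrite (card_imset _ sh_inj) IH; last first.
  by apply: leq_trans jN; rewrite (cardsD1 v F) vF addSn addnS ltnS.
rewrite IH; last by apply: leq_trans jN; rewrite addSn.
have -> : #|F| = #|F :\ v|.+1 by rewrite (cardsD1 v F) vF.
by rewrite !addSn !addnS /= binS.
Qed.

End HilbertFunction.

Section HilbertDim.
Variables (K : fieldType) (n : nat) (D : scomplex n).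
Local Notation S := {mpoly K[n]}.

Lemma SR_piZ c (p : S) : c *: (SR_pi D p : SR_ring K D) = SR_pi D (c *: p).
Proof. by rewrite -mul_mpolyC rmorphM. Qed.

Lemma SR_hilbert_dim j :
  has_dim (SR_homog (K := K) (D := D) j%:Z) #|face_monomials (faces D) j|.
Proof.
pose mon (i : 'I_#|face_monomials (faces D) j|) : 'X_{1..n} := bmnm (enum_val i).
have monP i : mdeg (mon i) = j /\ msup (mon i) \in faces D.
  by have := enum_valP i; rewrite inE => /andP[/eqP].
have mon_inj : injective mon by move=> i i' /val_inj/enum_val_inj.
have coefmon (c : 'rV[K]_#|face_monomials (faces D) j|) i :
    (\sum_i' c 0 i' *: 'X_[mon i'] : S)@_(mon i) = c 0 i.
  rewrite raddf_sum (bigD1 i) //= mcoeffZ mcoeffX eqxx mulr1 big1 ?addr0 //.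
  move=> i' ne; rewrite mcoeffZ mcoeffX (inj_eq mon_inj) (negbTE ne).
  by rewrite mulr0.
exists (fun i => SR_pi D 'X_[mon i]); split.
  move=> i; exists 'X_[mon i] => //; move=> m /mem_msuppXP <-.
  by have [->] := monP i.
move=> w [p /homog_ofP hp ->].
have sumE (c : 'rV[K]_#|face_monomials (faces D) j|) :
    \sum_i c 0 i *: (SR_pi D 'X_[mon i] : SR_ring K D) = SR_pi D (\sum_i c 0 i *: 'X_[mon i]).
  by rewrite rmorph_sum; apply: eq_bigr => i _; rewrite SR_piZ.
exists (\row_i p@_(mon i)); split.
  rewrite sumE; apply/eqP; rewrite -subr_eq0 -rmorphB; apply/eqP/SR_pi_eq0 => m mD.
  have [dm|ndm] := eqVneq (mdeg m) j; last first.
    rewrite mcoeffB hp ?eqz_nat // raddf_sum big1 ?subrr // => i _ /=.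
    rewrite mcoeffZ mcoeffX; case: (eqVneq (mon i) m) => [e|]; last by rewrite mulr0.
    by have [di _] := monP i; rewrite -e di eqxx in ndm.
  have ltm : (mdeg m < j.+1)%N by rewrite dm.
  have mS : BMultinom ltm \in face_monomials (faces D) j by rewrite inE /= dm eqxx.
  have -> : m = mon (enum_rank_in mS (BMultinom ltm)) by rewrite /mon enum_rankK_in.
  by rewrite mcoeffB coefmon mxE subrr.
move=> c'; rewrite sumE => /eqP; rewrite -subr_eq0 -rmorphB => /eqP/SR_pi_eq0 h.
apply/rowP => i; rewrite mxE; have [_ /h/eqP] := monP i.
by rewrite mcoeffB coefmon subr_eq0 => /eqP.
Qed.

End HilbertDim.

(** * Expansion of powers of 1/(1 - t) *)

Section PowerSeries.
Implicit Types (q : {poly int}) (h : nat -> int).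

Definition conv q h m : int := \sum_(i < m.+1) q`_i * h (m - i)%N.

(** The coefficient of t^j in 1/(1 - t)^s. *)
Definition simplex_hilb s j : int := 'C((j + s).-1, j).

Lemma convB q h h' m : conv q (fun j => h j - h' j) m = conv q h m - conv q h' m.
Proof. by rewrite /conv -sumrB; apply: eq_bigr => i _; rewrite mulrBr. Qed.

Lemma convZ q c h m : conv q (fun j => c * h j) m = c * conv q h m.
Proof. by rewrite /conv mulr_sumr; apply: eq_bigr => i _; rewrite mulrCA. Qed.

(** The factor 1 - X turns into a difference of consecutive values, which Pascal's rule
    evaluates. *)
Lemma conv_simplexS q s m :
  conv ((1 - 'X) * q) (simplex_hilb s.+1) m = conv q (simplex_hilb s) m.
Proof.
have h0 : simplex_hilb s.+1 0 = simplex_hilb s 0 by rewrite /simplex_hilb !bin0.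
have hS j : simplex_hilb s.+1 j.+1 - simplex_hilb s.+1 j = simplex_hilb s j.+1.
  rewrite /simplex_hilb !addSn !addnS /= binS PoszD addrK //.
have cX j : ((1 - 'X) * q)`_j = q`_j - (if j == 0%N then 0 else q`_j.-1).
  by rewrite mulrBl mul1r coefB coefXM.
rewrite /conv; under eq_bigr => i _ do rewrite cX mulrBl.
rewrite sumrB [X in _ - X]big_ord_recl /= mul0r add0r.
rewrite big_ord_recr /= [RHS]big_ord_recr /= subnn h0 addrAC; congr (_ + _).
rewrite -sumrB; apply: eq_bigr => i _; rewrite -mulrBr /bump /= add1n.
have -> : (m - i = (m - i.+1).+1)%N by rewrite subnSK.
by rewrite hS.
Qed.

Lemma conv_simplex0 q m : conv q (simplex_hilb 0) m = q`_m.
Proof.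
rewrite /conv big_ord_recr /= subnn big1 ?add0r ?mulr1 // => i _.
have -> : (m - i = (m - i.+1).+1)%N by rewrite subnSK.
by rewrite /simplex_hilb addn0 bin_small // mulr0.
Qed.

Lemma conv_simplex q s m : conv ((1 - 'X) ^+ s * q) (simplex_hilb s) m = q`_m.
Proof.
elim: s => [|s IH] in q *; first by rewrite expr0 mul1r conv_simplex0.
by rewrite exprS -mulrA conv_simplexS.
Qed.

End PowerSeries.

Lemma expf_subn (A : fieldType) (a : A) s t : a != 0 -> (t <= s)%N ->
  a ^+ (s - t) / a ^+ s = (a ^+ t)^-1.
Proof.
move=> a0 ts; rewrite -{2}(subnK ts) exprD invfM mulrA.
by rewrite divff ?mul1r // expf_neq0.
Qed.

Section ForestHilbert.
Variables (K : fieldType) (n : nat) (D : scomplex n) (k d1 r1 : nat).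
Variables (F G : nat -> {set 'I_n}) (par : nat -> nat).
Hypothesis fd : forest_data k d1 r1 (faces D) F G par.
Hypotheses (k2 : (2 <= k)%N) (r1d1 : (r1 < d1)%N).

Lemma forest_face_monomials j : (#|face_monomials (faces D) j|%:Z : int) =
  k%:Z * simplex_hilb d1 j - (k - 1)%N%:Z * simplex_hilb r1 j.
Proof.
rewrite -(first_facets_all fd).
suff H m : (0 < m <= k)%N -> (#|face_monomials (first_facets F m) j|%:Z : int) =
    m%:Z * simplex_hilb d1 j - (m - 1)%N%:Z * simplex_hilb r1 j.
  by apply: H; rewrite leqnn andbT (leq_trans _ k2).
elim: m => // m IH /andP[_ mk].
have cF : #|face_monomials (powerset (F m)) j|%:Z = simplex_hilb d1 j.
  by rewrite card_face_monomials (card_facet fd mk).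
have [m0|m0] := posnP m.
  rewrite first_facetsS (_ : first_facets F m = set0) ?set0U.
    by rewrite cF m0 subnn mul1r mul0r subr0.
  by apply/setP => s; rewrite in_set0; apply/negP => /in_first_facets[a]; rewrite m0.
have m0k : (0 < m < k)%N by rewrite m0.
have := face_monomialsUI (first_facets F m) (powerset (F m)) j.
rewrite -first_facetsS (first_facets_glue fd m0k) => /(congr1 Posz).
rewrite !PoszD cF IH; last by rewrite m0 ltnW.
rewrite card_face_monomials (card_glue fd m0k) -/(simplex_hilb r1 j).
move=> /(canRL (addrK _)) ->; rewrite subSS subn0 -(subzn m0).
have -> : m.+1%:Z = m%:Z + 1 by rewrite -addn1 PoszD.
by ring.
Qed.

Lemma forest_hilbert_series (d r : int) : d1%:Z = d + 1 -> r1%:Z = r + 1 ->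
  SR_hilbert_series K D
    (k%:R / (1 - 'X)%:F ^ (d + 1) - (k - 1)%N%:R / (1 - 'X)%:F ^ (r + 1)).
Proof.
move=> <- <-; exists (fun j => #|face_monomials (faces D) j|); split.
  by move=> j; apply: SR_hilbert_dim.
have X0 : (1 - 'X : {poly int}) != 0.
  by rewrite -oppr_eq0 opprB -polyC1 polyXsubC_eq0.
have F0 : (1 - 'X : {poly int})%:F != 0 by rewrite tofrac_eq0.
exists (k%:R - (k - 1)%N%:R * (1 - 'X) ^+ (d1 - r1)), ((1 - 'X) ^+ d1); split.
- exact: expf_neq0.
- rewrite [X in _ = X / _]rmorphB rmorphM rmorphXn [X in _ = _ / X]rmorphXn.
  rewrite !rmorph_nat /= mulrBl -!exprnP; congr (_ - _).
  by rewrite -mulrA (expf_subn F0 (ltnW r1d1)).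
move=> m; rewrite -/(conv _ (fun j => #|face_monomials (faces D) j|%:Z) m).
have -> : conv ((1 - 'X) ^+ d1) (fun j => #|face_monomials (faces D) j|%:Z) m =
    conv ((1 - 'X) ^+ d1)
      (fun j => k%:Z * simplex_hilb d1 j - (k - 1)%N%:Z * simplex_hilb r1 j) m.
  by apply: eq_bigr => i _; rewrite forest_face_monomials.
rewrite convB !convZ -{1}[(1 - 'X) ^+ d1]mulr1 conv_simplex.
rewrite -{1}(subnKC (ltnW r1d1)) exprD conv_simplex coefB.
rewrite -!polyC_natr -[k%:R%:P]mulr1 !coefCM !natz.
by [].
Qed.

End ForestHilbert.

(** * Krull dimension *)

Section PrimeChains.
Variables (K : fieldType) (A : comNzRingType) (kappa : {rmorphism K -> A}) (N : nat).

(** Exponent vectors with entries below [N], as nested pairs because the induction along a chain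
    peels off the first exponent. *)
Fixpoint mexp m : finType := if m is m'.+1 then ('I_N * mexp m')%type else unit.

Fixpoint mmon (B : pzSemiRingType) m (x : nat -> B) : mexp m -> B :=
  if m is m'.+1 then fun t => x 0%N ^+ t.1 * mmon (fun i => x i.+1) t.2
  else fun=> 1.

Lemma rmorph_mmon (B C : comNzRingType) (h : {rmorphism B -> C}) m
    (x : nat -> B) (y : nat -> C) (t : mexp m) :
  (forall i, y i = h (x i)) -> mmon y t = h (mmon x t).
Proof.
elim: m => [|m IH] in x y t * => e /=; first by rewrite rmorph1.
by rewrite rmorphM rmorphXn e (IH (fun i => x i.+1)) // => i; apply: e.
Qed.

Lemma card_mexp m : #|mexp m| = (N ^ m)%N.
Proof. by elim: m => [|m IH] /=; rewrite ?card_unit // card_prod card_ord IH expnS. Qed.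

(* Coquand and Lombardi: x_i in P_(i+1) \ P_i are algebraically independent
   modulo P_0; consider the lexicographically smallest monomial of a relation. *)
Lemma prime_chain_indep m (P : nat -> prime_idealr A) (x : nat -> A)
    (lam : mexp m -> K) :
  (forall i, (i < m)%N -> [/\ forall y, y \in P i -> y \in P i.+1,
      x i \in P i.+1 & x i \notin P i]) ->
  \sum_t kappa (lam t) * mmon x t \in P 0%N -> forall t, lam t = 0.
Proof.
elim: m => [|m IH] in P x lam * => chain.
  rewrite (bigD1 tt) //= big1 ?addr0; last by case.
  rewrite mulr1 => h [].
  apply/eqP/negPn/negP => l0; have := idealr1 (P 0%N).
  by rewrite -(rmorph1 kappa) -(mulVf l0) rmorphM idealMr.
set q := fun j : 'I_N => \sum_t kappa (lam (j, t)) * mmon (fun i => x i.+1) t.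
have -> : \sum_t kappa (lam t) * mmon x t = \sum_(j < N) x 0%N ^+ j * q j.
  rewrite /q; under [RHS]eq_bigr => j _ do rewrite mulr_sumr.
  rewrite pair_big; apply: eq_bigr => -[j t] _ /=.
  by rewrite mulrCA.
have [sub01 x1 x0] := chain 0%N isT.
move=> h; suff H (j : 'I_N) t : lam (j, t) = 0 by case.
have [M] := ubnP (val j); elim: M => // M IHM in j t *; rewrite ltnS => jM.
have q0 (j' : 'I_N) : (j' < j)%N -> q j' = 0.
  move=> j'j; rewrite /q big1 // => t' _.
  by rewrite IHM ?rmorph0 ?mul0r // (leq_trans j'j).
(* The powers below j drop out, so x_0^j can be factored out. As x_0 is not in the prime P_0, the
   cofactor is; since P_1 contains P_0 and x_0, it contains q_j, which is a relation for the shifted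
   chain. *)
have : x 0%N ^+ j * (q j + x 0%N *
    \sum_(j' < N | (j < j')%N) x 0%N ^+ (j' - j.+1) * q j') \in P 0%N.
  suff <- : \sum_(j0 < N) x 0%N ^+ j0 * q j0 = x 0%N ^+ j * (q j + x 0%N *
    \sum_(j' < N | (j < j')%N) x 0%N ^+ (j' - j.+1) * q j') by [].
  rewrite (bigID (fun j' : 'I_N => (j < j')%N)) /= addrC mulrDr; congr (_ + _).
    rewrite (bigD1 j) ?ltnn //= big1 ?addr0 // => j' /andP[].
    rewrite -leqNgt leq_eqVlt => /predU1P[/val_inj ->|/q0 ->]; first by rewrite eqxx.
    by rewrite mulr0.
  rewrite mulrA -exprSr mulr_sumr; apply: eq_bigr => j' jj'.
  by rewrite mulrA -exprD subnKC.
rewrite prime_idealrM => /orP[|/sub01 qP].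
  case: (val j) => [|j']; first by rewrite expr0 idealr1.
  elim: j' => [|j' IHj]; first by rewrite expr1 (negbTE x0).
  by rewrite exprS prime_idealrM (negbTE x0).
apply: (IH (fun i => P i.+1) (fun i => x i.+1) (fun t => lam (j, t))).
  by move=> i im; apply: chain.
rewrite -[X in X \in _]/(q j) -(addrK (x 0%N * \sum_(j' < N | (j < j')%N)
  x 0%N ^+ (j' - j.+1) * q j') (q j)).
by rewrite rpredB // mulrC idealMr.
Qed.

End PrimeChains.

Section Degrees.
Variables (K : fieldType) (n : nat).
Local Notation S := {mpoly K[n]}.

Definition deg_le B (p : S) := forall m, m \in msupp p -> (mdeg m <= B)%N.

Lemma deg_leM B C p q : deg_le B p -> deg_le C q -> deg_le (B + C) (p * q).
Proof.
move=> hp hq m /msuppM_le/allpairsP[[a b] /= [ap bq ->]].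
by rewrite mdegD leq_add ?hp ?hq.
Qed.

Lemma deg_le_trans B C p : (B <= C)%N -> deg_le B p -> deg_le C p.
Proof. by move=> BC h m /h /leq_trans; apply. Qed.

Lemma deg_le1 : deg_le 0 1.
Proof. by move=> m; rewrite msupp1 inE => /eqP ->; rewrite mdeg0. Qed.

Lemma deg_leX B p j : deg_le B p -> deg_le (j * B) (p ^+ j).
Proof.
move=> h; elim: j => [|j IH]; first by rewrite expr0 mul0n; apply: deg_le1.
by rewrite exprS mulSn; apply: deg_leM.
Qed.

Lemma deg_le_mmon B N m (f : nat -> S) (t : mexp N m) :
  (forall i, (i < m)%N -> deg_le B (f i)) -> deg_le (m * (N * B)) (mmon f t).
Proof.
elim: m => [|m IH] in f t * => h /=; first by apply: deg_le1.
rewrite mulSn; apply: deg_leM; last by apply: IH => i im; apply: h.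
apply: (@deg_le_trans (t.1 * B)).
  by rewrite leq_mul2r ltnW ?orbT.
exact: (deg_leX (h 0%N isT)).
Qed.

End Degrees.

Section KrullDim.
Variables (K : fieldType) (n : nat) (D : scomplex n) (k d1 r1 : nat).
Variables (F G : nat -> {set 'I_n}) (par : nat -> nat).
Hypothesis fd : forest_data k d1 r1 (faces D) F G par.
Hypothesis d1_gt0 : (0 < d1)%N.
Local Notation S := {mpoly K[n]}.
Local Notation R := (SR_ring K D).

Definition bounded_faces B : {set 'X_{1..n < B.+1}} := [set m | msup (bmnm m) \in faces D].

Lemma card_bounded_faces B : (#|bounded_faces B| <= k * B.+1 ^ d1)%N.
Proof.
pose f (m : 'X_{1..n < B.+1}) : {ffun 'I_n -> 'I_B.+1} := [ffun i => inord (m i)].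
have mB (m : 'X_{1..n < B.+1}) i : (m i <= B)%N.
  rewrite -ltnS; apply: leq_ltn_trans (bmdeg m); rewrite mdegE (bigD1 i) //=.
  exact: leq_addr.
have f_inj : injective f.
  move=> m m' /ffunP e; apply: val_inj; apply/mnmP => i; have := e i.
  by rewrite !ffunE => /(congr1 val); rewrite /= !inordK ?ltnS ?mB.
rewrite -(card_imset _ f_inj).
pose Q (a : 'I_k) := [set g : {ffun 'I_n -> 'I_B.+1} | g \in pffun_on ord0 (mem (F a)) predT].
have sub : f @: bounded_faces B \subset \bigcup_a Q a.
  apply/subsetP => _ /imsetP[m + ->]; rewrite inE => /(faceP fd)[a ak ma].
  apply/bigcupP; exists (Ordinal ak) => //; rewrite inE; apply/pffun_onP; split=> //.
  apply/subsetP => i; rewrite inE ffunE => mi; apply: (subsetP ma).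
  by rewrite inE; apply: contraNN mi => /eqP ->; apply/eqP/val_inj; rewrite /= inordK.
apply: leq_trans (subset_leq_card sub) _.
apply: (@leq_trans (\sum_(a < k) #|Q a|)).
  elim/big_rec2: _ => [|a V m _ le]; first by rewrite cards0.
  by apply: leq_trans (leq_card_setU _ _) _; rewrite leq_add2l.
rewrite -[X in (_ <= X * _)%N]card_ord -sum_nat_const leq_sum // => a _.
by rewrite cardsE card_pffun_on card_ord (card_facet fd (ltn_ord a)).
Qed.

(** The monomials with exponents below N in d1 + 1 elements number N^(d1+1), but their degrees are
    O(N), so they lie in a space of dimension O(N^d1) and are linearly dependent for large N. *)
Lemma SR_chain_bound q (P : nat -> prime_idealr R) : prime_chain q P -> (q <= d1)%N.
Proof.
move=> chain; rewrite leqNgt; apply/negP => d1q.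
have /choice[x xP] i : exists y : R, (i < q)%N -> y \in P i.+1 /\ y \notin P i.
  have [iq|] := boolP (i < q)%N; last by exists 0.
  by have [_ [y y1 y0]] := chain i iq; exists y.
have /choice[f fP] i : exists p : S, x i = SR_pi D p by apply: SR_pi_surj.
pose Dl := \max_(i < d1.+1) msize (f i).
have degf i : (i < d1.+1)%N -> deg_le Dl (f i).
  move=> id m /msize_mdeg_lt /ltnW /leq_trans; apply.
  exact: (leq_bigmax (Ordinal id)).
(* Chosen so that B + 1 <= N c and k c^d1 < N, whence k (B + 1)^d1 <= N^d1 k c^d1 < N^(d1+1). *)
pose c := (d1.+1 * Dl).+1; pose N := (k * c ^ d1).+1.
pose B := (d1.+1 * (N * Dl))%N.
have cardB : (#|bounded_faces B| < #|mexp N d1.+1|)%N.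
  rewrite card_mexp; apply: leq_ltn_trans (card_bounded_faces B) _.
  have le1 : (B.+1 <= N * c)%N by rewrite /B /c mulnS mulnCA addnC -addn1 leq_add2l.
  apply: (@leq_ltn_trans (k * (N * c) ^ d1)); first by rewrite leq_mul2l leq_exp2r ?le1 ?orbT.
  by rewrite expnMn mulnCA expnS [(N * _)%N]mulnC ltn_pmul2l ?expn_gt0.
pose M : 'M[K]_(#|mexp N d1.+1|, #|bounded_faces B|) :=
  \matrix_(t, u) (mmon f (enum_val t))@_(bmnm (enum_val u)).
have : kermx M != 0.
  rewrite -mxrank_eq0 mxrank_ker -lt0n subn_gt0.
  by apply: leq_ltn_trans cardB; apply: rank_leq_col.
case/rowV0Pn => y /sub_kermxP yM y0.
pose kappa : {rmorphism K -> R} := SR_pi D \o @mpolyC n K.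
pose lam t := y 0 (enum_rank t).
have lam0 : forall t, lam t = 0.
  apply: (@prime_chain_indep K R kappa N d1.+1 P x lam).
    move=> i id; have iq : (i < q)%N by apply: leq_trans id d1q.
    by have [] := xP i iq; have [] := chain i iq.
  suff -> : \sum_t kappa (lam t) * mmon x t = 0 by rewrite rpred0.
  have -> : \sum_t kappa (lam t) * mmon x t = SR_pi D (\sum_t lam t *: mmon f t).
    rewrite rmorph_sum; apply: eq_bigr => t _.
    rewrite -mul_mpolyC rmorphM; congr (_ * _).
    exact: (rmorph_mmon (h := SR_pi D) t fP).
  apply/SR_pi_eq0 => m mD; rewrite raddf_sum /=.
  under eq_bigr => t _ do rewrite mcoeffZ.
  have [mB|mB] := boolP (mdeg m < B.+1)%N; last first.
    rewrite big1 // => t _; rewrite memN_msupp_eq0 ?mulr0 //.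
    by apply: contraNN mB => h; rewrite ltnS; apply: (deg_le_mmon degf h).
  have mS : BMultinom mB \in bounded_faces B by rewrite inE.
  have /rowP/(_ (enum_rank_in mS (BMultinom mB))) := yM.
  rewrite !mxE (reindex_onto enum_rank enum_val) /= => [e|t _]; last exact: enum_valK.
  rewrite -[RHS]e; apply: eq_big => t; first by rewrite enum_rankK eqxx.
  by rewrite mxE enum_rankK enum_rankK_in.
case/eqP: y0; apply/rowP => t; rewrite mxE -(lam0 (enum_val t)) /lam.
by rewrite enum_valK.
Qed.

End KrullDim.

(** * Primes of faces *)

Section FacePrimes.
Variables (K : fieldType) (n : nat) (D : scomplex n).
Local Notation S := {mpoly K[n]}.
Local Notation R := (SR_ring K D).

(** Restricting p and q to the terms supported in E changes neither modulo the ideal. The product of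
    the restrictions is supported in E and lies in the ideal, so it is 0 in the domain S. *)
Lemma van_powerset_prime (E : {set 'I_n}) (p q : S) :
  van (powerset E) (p * q) -> van (powerset E) p \/ van (powerset E) q.
Proof.
pose res (p : S) := mfilter (fun m => msup m \in powerset E) p.
have dE := @down_closed_powerset n E.
have vres p' : van (powerset E) (p' - res p').
  by move=> m mE; rewrite mcoeffB mcoeff_mfilter mE subrr.
have res0 p' : res p' = 0 -> van (powerset E) p'.
  by move=> e; have := vres p'; rewrite e subr0.
move=> pq; suff : res p * res q = 0.
  by move=> /eqP; rewrite mulf_eq0 => /orP[]/eqP/res0; [left|right].
have rpq : van (powerset E) (res p * res q).
  have -> : res p * res q = p * q - q * (p - res p) - res p * (q - res q) by ring.
  by apply: vanB; [apply: vanB => //|]; apply: vanM.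
apply/mpolyP => m; rewrite mcoeff0; have [/rpq //|mE] := boolP (msup m \in powerset E).
rewrite mcoeffM big1 // => -[a b] /= /eqP e; rewrite !mcoeff_mfilter.
case: ifP; rewrite ?mul0r // => aE; case: ifP; rewrite ?mulr0 // => bE.
case/negP: mE; move: aE bE; rewrite !powersetE => aE bE.
by have := msupD a b; rewrite -e => ->; rewrite subUset aE.
Qed.

Section OneFace.
Variables (E : {set 'I_n}) (ED : E \in faces D).

Definition face_prime_pred (a : R) : bool :=
  `[< exists2 p, a = SR_pi D p & van (powerset E) p >].

Lemma face_prime_pi p : face_prime_pred (SR_pi D p) <-> van (powerset E) p.
Proof.
split=> [/asboolP[q /eqP]|h]; last by apply/asboolP; exists p.
rewrite -subr_eq0 -rmorphB => /eqP/SR_pi_eq0 pq Eq.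
rewrite -(subrK q p); apply: vanD => //; apply: van_sub pq.
by apply/subsetP => s; rewrite powersetE; apply: sub_face ED.
Qed.

(* The proof argument makes the predicate a key for structure inference. *)
Definition face_prime of E \in faces D : R -> bool := face_prime_pred.

Lemma face_prime_idealr : idealr_closed (face_prime ED).
Proof.
split.
- apply/asboolP; exists 0; first by rewrite rmorph0.
  exact: van0.
- rewrite -(rmorph1 (SR_pi D)); apply/negP => /face_prime_pi /(_ 0%MM).
  rewrite msup0 powersetE sub0set mcoeff1 eqxx => /(_ isT)/eqP.
  by rewrite oner_eq0.
- move=> a p q; have [a' ->] := SR_pi_surj a.
  move=> /asboolP[p' -> Ep] /asboolP[q' -> Eq].
  rewrite -rmorphM -rmorphD; apply/face_prime_pi.
  by apply: vanD => //; apply: vanM => //; apply: down_closed_powerset.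
Qed.

Lemma face_prime_closed : prime_idealr_closed (face_prime ED).
Proof.
move=> u v; have [p ->] := SR_pi_surj u; have [q ->] := SR_pi_surj v.
rewrite -rmorphM => /face_prime_pi/van_powerset_prime[] h; apply/orP.
  by left; apply/face_prime_pi.
by right; apply/face_prime_pi.
Qed.

HB.instance Definition _ := isIdealr.Build R (face_prime ED) face_prime_idealr.
HB.instance Definition _ := isPrimeIdealrClosed.Build R (face_prime ED) face_prime_closed.

End OneFace.

(** Deleting the vertices of E one at a time enlarges the prime, and the variable of the deleted
    vertex witnesses that the inclusion is strict. *)
Lemma facet_chain (E : {set 'I_n}) : E \in faces D ->
  exists P : nat -> prime_idealr R, prime_chain #|E| P.
Proof.
move=> ED; pose E' i := E :\: [set v in take i (enum E)].
have E'D i : E' i \in faces D by apply: sub_face ED _; apply: subsetDl.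
exists (fun i => face_prime (E'D i) : prime_idealr R) => i iE.
have [v _] : exists v, v \in E by apply/card_gt0P; apply: leq_ltn_trans iE.
have iE' : (i < size (enum E))%N by rewrite -cardE.
have sub : E' i.+1 \subset E' i.
  apply/subsetP => w; rewrite !inE (take_nth v) // mem_rcons inE negb_or.
  by move=> /andP[/andP[_ ->]].
split.
  move=> a; have [p ->] := SR_pi_surj a => /(face_prime_pi (E'D _)) h.
  by apply/(face_prime_pi (E'D _)); apply: van_sub h; rewrite powersetS.
pose w := nth v (enum E) i.
exists (SR_pi D 'X_w).
  apply/(face_prime_pi (E'D _)); apply: vanX; rewrite !inE (take_nth v) //.
  by rewrite mem_rcons inE eqxx.
apply/negP => /(face_prime_pi (E'D _)) /(_ U_(w)%MM).
rewrite msupU powersetE sub1set mcoeffX eqxx !inE => h.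
suff /h/eqP : (w \notin take i (enum E)) && (w \in E) by rewrite oner_eq0.
have -> : w \in E by rewrite -mem_enum mem_nth.
rewrite andbT; apply/negP => wt.
have : uniq (enum E) by apply: enum_uniq.
rewrite -(cat_take_drop i (enum E)) cat_uniq => /and3P[_ /hasPn + _].
move=> /(_ w); rewrite (drop_nth v) // inE eqxx => /(_ isT).
by rewrite wt.
Qed.

End FacePrimes.

(** * Vertex count and explicit Betti numbers *)

Section ForestBetti.
Variables (K : fieldType) (n : nat) (D : scomplex n) (k d1 r1 : nat).
Variables (F G : nat -> {set 'I_n}) (par : nat -> nat).
Hypothesis fd : forest_data k d1 r1 (faces D) F G par.
Hypotheses (k2 : (2 <= k)%N) (r1d1 : (r1 < d1)%N).

(** Each facet after the first brings [d1 - r1] new vertices. *)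
Lemma forest_card_vertices : (n = d1 + (k - 1) * (d1 - r1))%N.
Proof.
suff H m : (0 < m <= k)%N ->
    (#|\bigcup_(a < m) F a| = d1 + (m - 1) * (d1 - r1))%N.
  rewrite -H ?leqnn ?andbT ?(leq_trans _ k2) // -[LHS]card_ord -cardsT.
  congr #|pred_of_set _|; apply/esym/eqP; rewrite -subTset; apply/subsetP => v _.
  have /(faceP fd)[a ak] := vertex_face D v; rewrite sub1set => va.
  by apply/bigcupP; exists (Ordinal ak).
elim: m => // m IH /andP[_ mk]; rewrite big_ord_recr /=.
have [m0|m0] := posnP m.
  by rewrite m0 in mk *; rewrite big_ord0 set0U (card_facet fd mk) subnn mul0n addn0.
have m0k : (0 < m < k)%N by rewrite m0.
have eG : (\bigcup_(a < m) F a) :&: F m = G m.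
  apply/eqP; rewrite eqEsubset; apply/andP; split.
    apply/subsetP => v; rewrite inE => /andP[/bigcupP[a _ va] vm].
    by apply: (subsetP (glue_cap fd (ltn_ord a) mk)); rewrite inE va.
  rewrite subsetI (glue_sub fd m0k) andbT; apply: subset_trans (glue_par fd m0k) _.
  by apply: (bigcup_sup (Ordinal (par_lt fd m0k))).
rewrite cardsU eG IH; last by rewrite m0 (ltnW mk).
rewrite (card_facet fd mk) (card_glue fd m0k) subSS subn0 subn1 -{2}(prednK m0) mulSn.
by move: (m.-1 * _)%N r1d1 => w; lia.
Qed.

Lemma forest_gbetti (Fr : free_resolution K D) i (j : int) : (1 <= i)%N ->
  gbetti Fr i j = if j == i.+1%:Z then
    absz ((k * 'C((k - 1) * (d1 - r1), i.+1))%N%:Z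
          - ((k - 1) * 'C(k * (d1 - r1), i.+1))%N%:Z)%R else 0%N.
Proof.
case: i => // i _.
have k0 : (0 < k)%N by apply: leq_trans k2.

pose F' (a : 'I_k) := F a; pose G' (a : 'I_k) := G a.
(* The default value can only be reached at the root, which has no parent. *)
pose P' (a : 'I_k) : 'I_k := insubd a (par a).
have b0k (b : 'I_k) : (0 < b)%N -> (0 < b < k)%N by rewrite ltn_ord andbT.
have PE (b : 'I_k) : (0 < b)%N -> P' b = par b :> nat.
  move=> b0; rewrite val_insubd.
  by rewrite (ltn_trans (par_lt fd (b0k b b0)) (ltn_ord b)).
have Plt (b : 'I_k) : (0 < b)%N -> (P' b < b)%N.
  by move=> b0; rewrite PE // (par_lt fd (b0k b b0)).
have GF (b : 'I_k) : (0 < b)%N -> G' b \subset F' b.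
  by move=> b0; apply: (glue_sub fd (b0k b b0)).
have GP (b : 'I_k) : (0 < b)%N -> G' b \subset F' (P' b).
  by move=> b0; rewrite /F' PE //; apply: (glue_par fd (b0k b b0)).
have capG (a b : 'I_k) : (a < b)%N -> F' a :&: F' b \subset G' b.
  by move=> ab; apply: (glue_cap fd ab (ltn_ord b)).
have DF (s : {set 'I_n}) : s \in faces D <-> exists a, s \subset F' a.
  split=> [/(faceP fd)[a ak sa]|[a sa]]; first by exists (Ordinal ak).
  by apply/(faceP fd); exists a.
have cov v : exists a, v \in F' a.
  by have /DF[a] := vertex_face D v; rewrite sub1set; exists a.
rewrite (gbettiE Plt GF GP capG cov DF Fr i j); case: eqP => // _.
have := ncells_le Plt GF GP cov K i.
have nE := forest_card_vertices; have ld := ltnW r1d1.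
have cFc a : (a < k)%N -> #|~: F a| = ((k - 1) * (d1 - r1))%N.
  by move=> ak; rewrite cardsCs setCK card_ord (card_facet fd ak) nE addKn.
have cGc b : (0 < b < k)%N -> #|~: G b| = (k * (d1 - r1))%N.
  move=> bk; rewrite cardsCs setCK card_ord (card_glue fd bk) nE.
  by rewrite -addnBAC // -mulSn subn1 prednK.
have -> : ncells F' G' i.+3 false = (k * 'C((k - 1) * (d1 - r1), i.+2))%N.
  rewrite ncells_nodes; under eq_bigr => a _ do rewrite cFc //.
  by rewrite sum_nat_const card_ord.
have -> : ncells F' G' i.+2 true = ((k - 1) * 'C(k * (d1 - r1), i.+2))%N.
  rewrite ncells_edges (eq_bigr (fun=> 'C(k * (d1 - r1), i.+2))); last first.
    by move=> a a0; rewrite /G' cGc // b0k.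
  rewrite sum_nat_const; congr (_ * _)%N.
  rewrite subn1 -[in RHS](card_ord k) -(cardC1 (Ordinal k0)).
  by apply: eq_card => -[[|a] lta]; rewrite !inE -val_eqE.
(* [ncells_le] orders the two products, so the truncated difference is the absolute value. *)
by move=> le; rewrite -(distnEr le).
Qed.

End ForestBetti.

(** [betti] sums over the degrees of basis elements only. If [e] is not among them, the component of
    degree [e] of the free module is 0, and so is its Betti number. *)
Lemma betti_concentrated (K : fieldType) n (D : scomplex n)
    (Fr : free_resolution K D) i (e : int) : (1 <= i)%N ->
  (forall j, j != e -> gbetti Fr i j = 0%N) -> betti Fr i = gbetti Fr i e.
Proof.
case: i => // i _ h; rewrite /betti; set degs := map _ _.
have [ed|ed] := boolP (e \in undup degs).
  by rewrite (bigD1_seq e) ?undup_uniq //= big1 ?addn0.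
rewrite big_seq big1 => [|j jd]; last first.
  by apply: h; apply/eqP => je; case/negP: ed; rewrite -je.
apply/esym/eqP; rewrite -leqn0 /gbetti (leq_trans (leq_subr _ _)) //=.
apply: leq_trans (mxrankS (capmxSl _ _)) _; rewrite leqn0 mxrank_eq0.
apply/eqP/matrixP => l m; rewrite !mxE.
case: (eqVneq (fr_deg l) e) => [e'|_]; last by rewrite mul0rn.
case/negP: ed; rewrite mem_undup; apply/mapP; exists l => //.
by rewrite mem_enum.
Qed.

Theorem corollary6 (K : fieldType) (n : nat) (D : scomplex n) (d r : int)
    (k : nat) (hk : (2 <= k)%N) (hD : dr_forest d r k (faces D)) :
  [/\ SR_hilbert_series K D
        (k%:R / (1 - 'X)%:F ^ (d + 1) - (k - 1)%N%:R / (1 - 'X)%:F ^ (r + 1)),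
      exists2 p : nat, p%:Z = r + 2 & SR_depth K D p,
      SR_CohenMacaulay K D <-> r = d - 1
    & forall (F : free_resolution K D) (i : nat), (1 <= i)%N ->
        betti F i = gbetti F i (i.+1)%:Z /\
        gbetti F i (i.+1)%:Z =
          absz ((k * 'C((k - 1) * absz (d - r)%R, i.+1))%N%:Z
                - ((k - 1) * 'C(k * absz (d - r)%R, i.+1))%N%:Z)%R ].
Proof.
have [d1 [r1 [F [G [par [d1E r1E r1d1 fd]]]]]] := dr_forest_data hk hD.
have depthD : SR_depth K D r1.+1.
  split; first exact: (SR_depth_ge K fd hk r1d1).
  exact: (SR_depth_upper fd hk r1d1).
have k0 : (0 < k)%N by apply: leq_trans hk.
have [P chainP] : exists P : nat -> prime_idealr (SR_ring K D), prime_chain d1 P.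
  rewrite -(card_facet fd k0); apply: facet_chain.
  by apply/(faceP fd); exists 0%N.
have d1_gt0 : (0 < d1)%N by apply: leq_ltn_trans r1d1.
split.
- exact: (forest_hilbert_series K fd hk r1d1 d1E r1E).
- by exists r1.+1 => //; lia.
- split=> [[p [[s [szs sm sreg]] _] [_ bound]]|rd].
    (* The dimension is at least d1 and the depth at most r1 + 1, so r1 < d1 leaves only d1 = r1 +
       1. *)
    have d1p : (d1 <= p)%N := bound _ _ chainP.
    have := SR_depth_upper fd hk r1d1 sm sreg; rewrite szs => pr.
    by lia.
  exists r1.+1 => //; have -> : r1.+1 = d1 by lia.
  split; first by exists P.
  by move=> q Q; apply: (SR_chain_bound fd d1_gt0).
- move=> Fr i i1; have dr : absz (d - r) = (d1 - r1)%N by lia.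
  rewrite dr -(betti_concentrated (Fr := Fr) i1) => [|j ji]; last first.
    by rewrite (forest_gbetti fd hk r1d1) // (negbTE ji).
  split=> //; rewrite (betti_concentrated (e := i.+1%:Z) i1) => [|j ji]; last first.
    by rewrite (forest_gbetti fd hk r1d1) // (negbTE ji).
  by rewrite (forest_gbetti fd hk r1d1) // eqxx.
Qed.
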